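(* Consider the class of equations $$u_t+uu_x+\alpha(t)u+\beta(t)u_{xxxxx}=0,\qquad \beta\neq0,$$ where $\alpha,\beta$ are smooth functions of $t$, and put $T=\int e^{-\int\alpha(t)\,dt}dt$. The following is the complete list of Lie symmetry extensions for this class, in which the arbitrary elements are not simplified by point transformations (group classification using no equivalence). The function $\alpha(t)$ is arbitrary in all cases; for each form of $\beta(t)$ a basis of the maximal Lie invariance algebra $A^{\max}$ is given. 0. $\beta$ arbitrary (no extension): $\partial_x,\ T\partial_x+T_t\partial_u$. In each of the following cases the basis of $A^{\max}$ consists of $\partial_x$, $T\partial_x+T_t\partial_u$ and the listed operators. 1. $\beta=\lambda T_t(aT+b)^\rho(cT+d)^{3-\rho}$: $$5T_t^{-1}(aT+b)(cT+d)\partial_t+\bigl[5acT+ad(\rho+1)+bc(4-\rho)\bigr]x\partial_x+\Bigl(5acxT_t-\bigl[5acT+5\alpha T_t^{-1}(aT+b)(cT+d)+bc(\rho+1)+ad(4-\rho)\bigr]u\Bigr)\partial_u.$$ 2. $\beta=\lambda T_t(cT+d)^3\exp\left(\frac{aT+b}{cT+d}\right)$: $$5T_t^{-1}(cT+d)^2\partial_t+(5c(cT+d)+\Delta)x\partial_x+\left[5c^2xT_t+\left(\Delta-5(cT+d)(c+\alpha(cT+d)T_t^{-1})\right)u\right]\partial_u.$$ 3. $\beta=\lambda T_t\,e^{5\nu\arctan\left(\frac{aT+b}{cT+d}\right)}\mathcal H^3$: $$T_t^{-1}\mathcal H^2\partial_t+\bigl[a(aT+b)+c(cT+d)+\nu\Delta\bigr]x\partial_x+\bigl[(a^2+c^2)xT_t-\bigl(a(aT+b)+c(cT+d)-\nu\Delta+\alpha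 T_t^{-1}\mathcal H^2\bigr)u\bigr]\partial_u.$$ 4a. $\beta=\lambda T_t$: $$T_t^{-1}(\partial_t-\alpha u\partial_u),\qquad 5TT_t^{-1}\partial_t+x\partial_x-(4+5TT_t^{-1}\alpha)u\partial_u.$$ 4b. $\beta=T_t(cT+d)^3$: $$5T_t^{-1}(cT+d)\partial_t+4cx\partial_x-(c+5T_t^{-1}(cT+d)\alpha)u\partial_u,$$ $$T_t^{-1}(cT+d)^2\partial_t+c(cT+d)x\partial_x+[c^2xT_t-(cT+d)(c+T_t^{-1}(cT+d)\alpha)u]\partial_u.$$ Here $a,b,c,d,\lambda,\nu,\rho$ are arbitrary constants with $\lambda\neq0$, $\rho\neq0,3$, and $\Delta=ad-bc\neq0$; $\mathcal H=\sqrt{(aT+b)^2+(cT+d)^2}$.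
   Context: Subscripts $t$ and $x$ denote derivatives, so $T_t=e^{-\int\alpha(t)\,dt}$ with the antiderivatives fixed. The maximal Lie invariance algebra $A^{\max}$ of an equation is the Lie algebra of all vector fields $Q=\tau(t,x,u)\partial_t+\xi(t,x,u)\partial_x+\eta(t,x,u)\partial_u$ satisfying the infinitesimal invariance criterion: the fifth prolongation $Q^{(5)}$ applied to the left-hand side of the equation vanishes on the manifold defined by the equation in the fifth-order jet space. A Lie symmetry extension is a case in which $A^{\max}$ is larger than the algebra $\langle\partial_x,\ T\partial_x+T_t\partial_u\rangle$ admitted for arbitrary $\beta$.
   Formalization: In Case 4b the formal statement requires c ≠ 0: for c = 0 the coefficient is β = d³T_t, which is Case 4a, and the two operators listed in 4b are proportional, so they cannot be part of a basis. *)

(* Defs.v *)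
From Stdlib Require Import Reals List.
From Coquelicot Require Import Coquelicot.
Import ListNotations.
Open Scope R_scope.

Definition nonempty_open_interval (J : R -> Prop) : Prop :=
  open J
  /\ (forall a b s, J a -> J b -> a <= s <= b -> J s)
  /\ exists s, J s.

Definition smooth1 (J : R -> Prop) (f : R -> R) : Prop :=
  forall n t, J t -> ex_derive_n f n t.

(** Vector fields live on a box J x X x U in the space of (t,x,u).  All
    functions are total on [R]; only their values on the box matter. *)
Definition on_box (J X U : R -> Prop) (P : R -> R -> R -> Prop) : Prop :=
  forall t x u, J t -> X x -> U u -> P t x u.

Inductive dir := dir_t | dir_x | dir_u.

Definition pd1 (d : dir) (f : R -> R -> R -> R) (t x u : R) : R :=
  match d with
  | dir_t => Derive (fun s => f s x u) t
  | dir_x => Derive (fun s => f t s u) x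
  | dir_u => Derive (fun s => f t x s) u
  end.

Definition ex_pd1 (d : dir) (f : R -> R -> R -> R) (t x u : R) : Prop :=
  match d with
  | dir_t => ex_derive (fun s => f s x u) t
  | dir_x => ex_derive (fun s => f t s u) x
  | dir_u => ex_derive (fun s => f t x s) u
  end.

Definition pd (w : list dir) (f : R -> R -> R -> R) : R -> R -> R -> R :=
  fold_right pd1 f w.

(** C^infinity: all iterated partial derivatives, in every order of
    differentiation, exist and are jointly continuous on the box. *)
Definition smooth3 (J X U : R -> Prop) (f : R -> R -> R -> R) : Prop :=
  forall w, on_box J X U (fun t x u =>
    continuous (fun q : R * R * R => pd w f (fst (fst q)) (snd (fst q)) (snd q))
               ((t, x), u)
    /\ forall d, ex_pd1 d (pd w f) t x u).

(** The vector field tau d/dt + xi d/dx + eta d/du. *)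
Record vfield := VF {
  vtau : R -> R -> R -> R;
  vxi  : R -> R -> R -> R;
  veta : R -> R -> R -> R }.

Definition vf_smooth (J X U : R -> Prop) (Q : vfield) : Prop :=
  smooth3 J X U (vtau Q) /\ smooth3 J X U (vxi Q) /\ smooth3 J X U (veta Q).

Definition vf_eq (J X U : R -> Prop) (Q P : vfield) : Prop :=
  on_box J X U (fun t x u =>
    vtau Q t x u = vtau P t x u
    /\ vxi Q t x u = vxi P t x u
    /\ veta Q t x u = veta P t x u).

Definition vf_zero : vfield :=
  VF (fun _ _ _ => 0) (fun _ _ _ => 0) (fun _ _ _ => 0).

Definition vf_add (Q P : vfield) : vfield :=
  VF (fun t x u => vtau Q t x u + vtau P t x u)
     (fun t x u => vxi Q t x u + vxi P t x u)
     (fun t x u => veta Q t x u + veta P t x u).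

Definition vf_scal (k : R) (Q : vfield) : vfield :=
  VF (fun t x u => k * vtau Q t x u)
     (fun t x u => k * vxi Q t x u)
     (fun t x u => k * veta Q t x u).

Definition vf_comb (ks : list R) (B : list vfield) : vfield :=
  fold_right (fun kQ acc => vf_add (vf_scal (fst kQ) (snd kQ)) acc)
             vf_zero (combine ks B).

Definition in_span (J X U : R -> Prop) (B : list vfield) (Q : vfield) : Prop :=
  exists ks, length ks = length B /\ vf_eq J X U Q (vf_comb ks B).

Definition is_basis (J X U : R -> Prop) (V : vfield -> Prop) (B : list vfield)
  : Prop :=
  (forall Q, In Q B -> V Q)
  /\ (forall Q, V Q -> in_span J X U B Q)
  /\ (forall ks, length ks = length B ->
        vf_eq J X U (vf_comb ks B) vf_zero -> forall k, In k ks -> k = 0).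

(** Jet coordinates: [cu i j] is the derivative of u taken i times in t and
    j times in x.  The coordinates with i + j > 5 are inert: nothing
    below that concerns the fifth-order jet space depends on them. *)
Inductive coord := ct | cx | cu (i j : nat).

Definition coord_eq_dec (c c' : coord) : {c = c'} + {c <> c'}.
Proof. decide equality; apply PeanoNat.Nat.eq_dec. Defined.

Definition jet := coord -> R.

Definition jet_upd (p : jet) (c : coord) (s : R) : jet :=
  fun c' => if coord_eq_dec c' c then s else p c'.

Definition partial (c : coord) (F : jet -> R) (p : jet) : R :=
  Derive (fun s => F (jet_upd p c s)) (p c).

(** Sum over all (i,j) with i + j <= n. *)
Definition sum_jet (n : nat) (f : nat -> nat -> R) : R :=
  sum_f_R0 (fun i => sum_f_R0 (fun j => f i j) (n - i)) n.

(** Total derivatives of functions of jet order at most 4. *)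
Definition total_Dt (F : jet -> R) (p : jet) : R :=
  partial ct F p
  + sum_jet 4 (fun i j => p (cu (S i) j) * partial (cu i j) F p).

Definition total_Dx (F : jet -> R) (p : jet) : R :=
  partial cx F p
  + sum_jet 4 (fun i j => p (cu i (S j)) * partial (cu i j) F p).

Definition lift (f : R -> R -> R -> R) (p : jet) : R :=
  f (p ct) (p cx) (p (cu 0 0)).

(** Coefficient of the prolongation of Q at d/d(cu i j), i + j <= 5, by the
    recursion eta^{K,y} = D_y eta^K - (D_y tau) u_{K,t} - (D_y xi) u_{K,x}. *)
Fixpoint prol_coef_x (Q : vfield) (j : nat) : jet -> R :=
  match j with
  | O => lift (veta Q)
  | S j' => fun p =>
      total_Dx (prol_coef_x Q j') p
      - total_Dx (lift (vtau Q)) p * p (cu 1 j')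
      - total_Dx (lift (vxi Q)) p * p (cu 0 (S j'))
  end.

Fixpoint prol_coef (Q : vfield) (i j : nat) : jet -> R :=
  match i with
  | O => prol_coef_x Q j
  | S i' => fun p =>
      total_Dt (prol_coef Q i' j) p
      - total_Dt (lift (vtau Q)) p * p (cu (S i') j)
      - total_Dt (lift (vxi Q)) p * p (cu i' (S j))
  end.

(** Action of the fifth prolongation of Q on a function on J^5. *)
Definition prolong5 (Q : vfield) (F : jet -> R) (p : jet) : R :=
  lift (vtau Q) p * partial ct F p
  + lift (vxi Q) p * partial cx F p
  + sum_jet 5 (fun i j => prol_coef Q i j p * partial (cu i j) F p).

Definition eqn_lhs (alpha beta : R -> R) (p : jet) : R :=
  p (cu 1 0) + p (cu 0 0) * p (cu 0 1)
  + alpha (p ct) * p (cu 0 0) + beta (p ct) * p (cu 0 5).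

Definition Amax (J X U : R -> Prop) (alpha beta : R -> R) (Q : vfield) : Prop :=
  vf_smooth J X U Q
  /\ forall p : jet, J (p ct) -> X (p cx) -> U (p (cu 0 0)) ->
       eqn_lhs alpha beta p = 0 -> prolong5 Q (eqn_lhs alpha beta) p = 0.

Definition admissible (J : R -> Prop) (beta : R -> R) : Prop :=
  smooth1 J beta /\ forall t, J t -> beta t <> 0.

(** [is_rpow z r y]: the real power z^r is defined, nonzero and equal to y.
    Negative bases are allowed only for integer exponents. *)
Definition is_rpow (z r y : R) : Prop :=
  (0 < z /\ y = Rpower z r)
  \/ (z <> 0 /\ exists n : Z, r = IZR n /\ y = powerRZ z n).

Definition kernel_ops (T : R -> R) : list vfield :=
  [ VF (fun _ _ _ => 0) (fun _ _ _ => 1) (fun _ _ _ => 0);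
    VF (fun _ _ _ => 0) (fun t _ _ => T t) (fun t _ _ => Derive T t) ].

Definition op1 (alpha T : R -> R) (a b c d rho : R) : vfield :=
  VF (fun t _ _ => 5 * / Derive T t * (a * T t + b) * (c * T t + d))
     (fun t x _ =>
        (5 * a * c * T t + a * d * (rho + 1) + b * c * (4 - rho)) * x)
     (fun t x u =>
        5 * a * c * x * Derive T t
        - (5 * a * c * T t
           + 5 * alpha t * / Derive T t * (a * T t + b) * (c * T t + d)
           + b * c * (rho + 1) + a * d * (4 - rho)) * u).

Definition op2 (alpha T : R -> R) (a b c d : R) : vfield :=
  let Delta := a * d - b * c in
  VF (fun t _ _ => 5 * / Derive T t * (c * T t + d) ^ 2)
     (fun t x _ => (5 * c * (c * T t + d) + Delta) * x)
     (fun t x u =>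
        5 * c ^ 2 * x * Derive T t
        + (Delta - 5 * (c * T t + d)
                     * (c + alpha t * (c * T t + d) * / Derive T t)) * u).

Definition calH (T : R -> R) (a b c d t : R) : R :=
  sqrt ((a * T t + b) ^ 2 + (c * T t + d) ^ 2).

Definition op3 (alpha T : R -> R) (a b c d nu : R) : vfield :=
  let Delta := a * d - b * c in
  VF (fun t _ _ => / Derive T t * calH T a b c d t ^ 2)
     (fun t x _ =>
        (a * (a * T t + b) + c * (c * T t + d) + nu * Delta) * x)
     (fun t x u =>
        (a ^ 2 + c ^ 2) * x * Derive T t
        - (a * (a * T t + b) + c * (c * T t + d) - nu * Delta
           + alpha t * / Derive T t * calH T a b c d t ^ 2) * u).

Definition ops4a (alpha T : R -> R) : list vfield :=
  [ VF (fun t _ _ => / Derive T t)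
       (fun _ _ _ => 0)
       (fun t _ u => - (/ Derive T t * alpha t * u));
    VF (fun t _ _ => 5 * T t * / Derive T t)
       (fun _ x _ => x)
       (fun t _ u => - ((4 + 5 * T t * / Derive T t * alpha t) * u)) ].

Definition ops4b (alpha T : R -> R) (c d : R) : list vfield :=
  [ VF (fun t _ _ => 5 * / Derive T t * (c * T t + d))
       (fun _ x _ => 4 * c * x)
       (fun t _ u => - ((c + 5 * / Derive T t * (c * T t + d) * alpha t) * u));
    VF (fun t _ _ => / Derive T t * (c * T t + d) ^ 2)
       (fun t x _ => c * (c * T t + d) * x)
       (fun t x u =>
          c ^ 2 * x * Derive T t
          - (c * T t + d) * (c + / Derive T t * (c * T t + d) * alpha t) * u) ].

(** [extension_case J alpha T beta ops]: on J, beta has one of the listed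
    forms, and ops are the operators listed for that form. *)
Inductive extension_case (J : R -> Prop) (alpha T beta : R -> R)
  : list vfield -> Prop :=
| Case1 (lam a b c d rho : R) :
    lam <> 0 -> rho <> 0 -> rho <> 3 -> a * d - b * c <> 0 ->
    (forall t, J t -> exists y z,
        is_rpow (a * T t + b) rho y /\ is_rpow (c * T t + d) (3 - rho) z
        /\ beta t = lam * Derive T t * y * z) ->
    extension_case J alpha T beta [op1 alpha T a b c d rho]
| Case2 (lam a b c d : R) :
    lam <> 0 -> a * d - b * c <> 0 ->
    (forall t, J t -> c * T t + d <> 0
        /\ beta t = lam * Derive T t * (c * T t + d) ^ 3
                    * exp ((a * T t + b) / (c * T t + d))) ->
    extension_case J alpha T beta [op2 alpha T a b c d]
| Case3 (lam a b c d nu : R) :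
    lam <> 0 -> a * d - b * c <> 0 ->
    (forall t, J t -> c * T t + d <> 0
        /\ beta t = lam * Derive T t
                    * exp (5 * nu * atan ((a * T t + b) / (c * T t + d)))
                    * calH T a b c d t ^ 3) ->
    extension_case J alpha T beta [op3 alpha T a b c d nu]
| Case4a (lam : R) :
    lam <> 0 ->
    (forall t, J t -> beta t = lam * Derive T t) ->
    extension_case J alpha T beta (ops4a alpha T)
(* For c = 0 this form is that of Case4a and the two operators are linearly
   dependent. *)
| Case4b (c d : R) :
    c <> 0 ->
    (forall t, J t -> beta t = Derive T t * (c * T t + d) ^ 3) ->
    extension_case J alpha T beta (ops4b alpha T c d).

(* Main.v *)
Require Import Defs.
From Stdlib Require Import Reals List Lra Lia Classical.
From Coquelicot Require Import Coquelicot.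
Import ListNotations.
Open Scope R_scope.

(** Fifth-order invariance is a polynomial identity in the jet coordinates once
    [u_t] is eliminated.  The coefficient of [u_txxxx] forces [tau = tau(t)], that
    of [u_xxxxx] forces [xi = h(t) x + xi0(t)] with
    [5 beta h = tau beta' + beta tau'], that of [u_xxxx] makes [eta] affine in [u],
    and that of [u_x] gives [eta = (h - tau') u + h' x + xi0'].  The remaining terms
    are linear ODEs, solved in the variable [T] by [h = k T + m],
    [xi0 = p T + q], [tau T_t = S(T)] with [S(T) = k T^2 + l T + n].  Writing
    [beta = T_t g(T)], the relation between [beta], [tau] and [h] becomes
    [S g' / g = 3 k T + 5 m - l]: extensions correspond to the functions [g] whose
    logarithmic derivative is such a quotient.  Distinct real roots of [S] (one
    possibly at infinity) give Case 1, a double root Case 2, complex roots Case 3,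
    and a root shared by [S] and the numerator leaves a cube of a linear function,
    Cases 4a and 4b.  In Cases 1-3 numerator and denominator are coprime, which
    makes the quotient, hence the extension, unique up to scaling. *)

(** The obstacle is the fifth prolongation itself: five nested total derivatives of unknown
    functions, taken with [Derive], do not compute. They are therefore mirrored by symbolic terms on
    which the total derivative reduces, and invariance is probed only at sparse jets, where the
    difference of two instances isolates one coefficient. Each coefficient is expanded only after
    the previous one has simplified the field, so no full expansion ever appears. Both directions
    then reduce to linear algebra on [(k, l, n, m)], because [1], [T], [T^2] are independent on
    every interval ([T_t] never vanishes) and the quadruple is determined by the field. The
    exponents [rho] and [3 - rho] are residues: the quotient of [3 k T + 5 m - l] by [S] behaves
    like [3 / T] at infinity when [k] is nonzero, so its residues at the two roots of [S] sum to 3.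
    The same 3 is the exponent of the linear function in Cases 2 and 4b and of [calH] in Case 3.
    Real powers and logarithms constrain signs, while the listed forms allow negative bases. Squares
    of [beta] settle this when a form is given, and sign changes of the linear factors when a form
    is to be found. *)

Lemma sum_jet_ext n f g :
  (forall i j, f i j = g i j) -> sum_jet n f = sum_jet n g.
Proof.
  intros H; unfold sum_jet; apply sum_eq; intros i _.
  apply sum_eq; intros j _; apply H.
Qed.

(** * Total derivatives on the box and the invariance criterion for the equation *)

Section JetCalculus.

Variables J X U : R -> Prop.
Hypothesis oJ : open J.
Hypothesis oX : open X.
Hypothesis oU : open U.

Definition inbox (p : jet) : Prop := J (p ct) /\ X (p cx) /\ U (p (cu 0 0)).

Definition eq_on_box (F G : jet -> R) : Prop := forall p, inbox p -> F p = G p.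

Lemma inbox_upd_locally p c : inbox p -> locally (p c) (fun s => inbox (jet_upd p c s)).
Proof.
  intros (Ht & Hx & Hu); unfold inbox.
  assert (E : forall (V : R -> Prop) c', open V -> V (p c') ->
            locally (p c) (fun s => V (jet_upd p c s c'))).
  { intros V c' oV Vp; unfold jet_upd; destruct (coord_eq_dec c' c) as [->|_].
    - now apply oV.
    - now apply filter_forall. }
  repeat apply filter_and; now apply E.
Qed.

Lemma partial_ext F G p c : eq_on_box F G -> inbox p -> partial c F p = partial c G p.
Proof.
  intros E Hp; unfold partial; apply Derive_ext_loc.
  generalize (inbox_upd_locally p c Hp); apply filter_imp; intros s; apply E.
Qed.

Lemma total_Dx_ext F G : eq_on_box F G -> eq_on_box (total_Dx F) (total_Dx G).
Proof.
  intros E p Hp; unfold total_Dx; rewrite (partial_ext F G) by trivial.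
  f_equal; apply sum_jet_ext; intros i j; now rewrite (partial_ext F G).
Qed.

Lemma lift_ext f g : on_box J X U (fun t x u => f t x u = g t x u) ->
  eq_on_box (lift f) (lift g).
Proof. intros E p (Ht & Hx & Hu); now apply E. Qed.

Lemma partial_lift f p c :
  partial c (lift f) p =
  match c with
  | ct => pd1 dir_t f (p ct) (p cx) (p (cu 0 0))
  | cx => pd1 dir_x f (p ct) (p cx) (p (cu 0 0))
  | cu 0 0 => pd1 dir_u f (p ct) (p cx) (p (cu 0 0))
  | _ => 0
  end.
Proof.
  destruct c as [| |[|i] [|j]]; unfold partial, lift, jet_upd, pd1; cbn;
    try reflexivity; apply Derive_const.
Qed.

Lemma total_Dx_lift f p : total_Dx (lift f) p
  = lift (pd1 dir_x f) p + p (cu 0 1) * lift (pd1 dir_u f) p.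
Proof.
  unfold total_Dx, sum_jet; cbn -[pd1]; rewrite !partial_lift; unfold lift; ring.
Qed.

Lemma total_Dt_lift f p : total_Dt (lift f) p
  = lift (pd1 dir_t f) p + p (cu 1 0) * lift (pd1 dir_u f) p.
Proof.
  unfold total_Dt, sum_jet; cbn -[pd1]; rewrite !partial_lift; unfold lift; ring.
Qed.

(** Only the coordinates [t], [u], [u_x], [u_t] and [u_xxxxx] occur in the equation. The first-order
    coefficients are expanded here; [prol_coef_x Q 5] stays folded, since it is treated differently
    for each determining equation. *)
Lemma prolong5_eqn_lhs alpha beta Q p :
  ex_derive alpha (p ct) -> ex_derive beta (p ct) ->
  prolong5 Q (eqn_lhs alpha beta) p =
  let tau := lift (vtau Q) p in let xi := lift (vxi Q) p in let eta := lift (veta Q) p in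
  let u := p (cu 0 0) in let u1 := p (cu 0 1) in let ut := p (cu 1 0) in
  let D d g := lift (pd1 d g) p in
  tau * (Derive alpha (p ct) * u + Derive beta (p ct) * p (cu 0 5))
  + eta * (u1 + alpha (p ct))
  + u * (D dir_x (veta Q) + u1 * D dir_u (veta Q)
         - (D dir_x (vtau Q) + u1 * D dir_u (vtau Q)) * ut
         - (D dir_x (vxi Q) + u1 * D dir_u (vxi Q)) * u1)
  + (D dir_t (veta Q) + ut * D dir_u (veta Q)
         - (D dir_t (vtau Q) + ut * D dir_u (vtau Q)) * ut
         - (D dir_t (vxi Q) + ut * D dir_u (vxi Q)) * u1)
  + beta (p ct) * prol_coef_x Q 5 p.
Proof.
  intros Ha Hb.
  assert (E : forall c, partial c (eqn_lhs alpha beta) p =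
    match c with
    | ct => Derive alpha (p ct) * p (cu 0 0) + Derive beta (p ct) * p (cu 0 5)
    | cu 0 0 => p (cu 0 1) + alpha (p ct)
    | cu 0 1 => p (cu 0 0)
    | cu 1 0 => 1
    | cu 0 5 => beta (p ct)
    | _ => 0
    end).
  { intros c; unfold partial; apply is_derive_unique.
    destruct c as [| |[|[|i]] [|[|[|[|[|[|j]]]]]]]; unfold eqn_lhs, jet_upd; cbn -[Rmult Rplus];
    auto_derive; repeat split; trivial;
    try change (fun x => alpha x) with alpha; try change (fun x => beta x) with beta; ring. }
  unfold prolong5, sum_jet; cbn -[total_Dx total_Dt prol_coef_x lift pd1].
  rewrite !E.
  change (prol_coef_x Q 0) with (lift (veta Q)).
  replace (prol_coef_x Q 1 p) with (total_Dx (lift (veta Q)) p - total_Dx (lift (vtau Q)) p * p (cu 1 0) - total_Dx (lift (vxi Q)) p * p (cu 0 1)) by reflexivity.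
  rewrite !total_Dx_lift, !total_Dt_lift; cbv beta zeta; ring.
Qed.

End JetCalculus.

(** * Differential polynomials *)

Section DifferentialPolynomials.

Variables J X U : R -> Prop.

Lemma smooth3_pd1 d f : smooth3 J X U f -> smooth3 J X U (pd1 d f).
Proof.
  intros Hf w t x u Ht Hx Hu.
  generalize (Hf (w ++ [d]) t x u Ht Hx Hu); unfold pd; now rewrite fold_right_app.
Qed.

Lemma smooth3_ex_pd1 d f : smooth3 J X U f -> on_box J X U (ex_pd1 d f).
Proof. intros Hf t x u Ht Hx Hu; apply (Hf [] t x u Ht Hx Hu). Qed.

(** Syntax for differential polynomials with function coefficients. On terms the total derivative is
    computed by reduction, and smoothness of the function leaves is the only analytic condition,
    inherited through every further derivative. *)
Inductive jterm :=
| JFun (f : R -> R -> R -> R)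
| JVar (i j : nat)
| JAdd (e1 e2 : jterm)
| JSub (e1 e2 : jterm)
| JMul (e1 e2 : jterm).

Fixpoint denote (e : jterm) (p : jet) : R :=
  match e with
  | JFun f => lift f p
  | JVar i j => p (cu i j)
  | JAdd e1 e2 => denote e1 p + denote e2 p
  | JSub e1 e2 => denote e1 p - denote e2 p
  | JMul e1 e2 => denote e1 p * denote e2 p
  end.

Fixpoint jsmooth (e : jterm) : Prop :=
  match e with
  | JFun f => smooth3 J X U f
  | JVar _ _ => True
  | JAdd e1 e2 | JSub e1 e2 | JMul e1 e2 => jsmooth e1 /\ jsmooth e2
  end.

(** Zero as [u - u]: without a function leaf, [jsmooth] of it is trivially true. *)
Definition jzero : jterm := JSub (JVar 0 0) (JVar 0 0).

Fixpoint jpartial (c : coord) (e : jterm) : jterm :=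
  match e with
  | JFun f =>
      match c with
      | ct => JFun (pd1 dir_t f)
      | cx => JFun (pd1 dir_x f)
      | cu 0 0 => JFun (pd1 dir_u f)
      | _ => jzero
      end
  | JVar i j => if coord_eq_dec (cu i j) c then JFun (fun _ _ _ => 1) else jzero
  | JAdd e1 e2 => JAdd (jpartial c e1) (jpartial c e2)
  | JSub e1 e2 => JSub (jpartial c e1) (jpartial c e2)
  | JMul e1 e2 => JAdd (JMul (jpartial c e1) e2) (JMul e1 (jpartial c e2))
  end.

(* [total_Dx] differentiates only in the jet coordinates of order at most 4. *)
Fixpoint jDx (e : jterm) : jterm :=
  match e with
  | JFun f => JAdd (JFun (pd1 dir_x f)) (JMul (JVar 0 1) (JFun (pd1 dir_u f)))
  | JVar i j => if Nat.leb (i + j) 4 then JVar i (S j) else jzero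
  | JAdd e1 e2 => JAdd (jDx e1) (jDx e2)
  | JSub e1 e2 => JSub (jDx e1) (jDx e2)
  | JMul e1 e2 => JAdd (JMul (jDx e1) e2) (JMul e1 (jDx e2))
  end.

Lemma jsmooth_jDx e : jsmooth e -> jsmooth (jDx e).
Proof.
  induction e as [f|i j|e1 IH1 e2 IH2|e1 IH1 e2 IH2|e1 IH1 e2 IH2]; simpl.
  - intros; repeat split; now apply smooth3_pd1.
  - destruct (Nat.leb (i + j) 4); simpl; tauto.
  - tauto.
  - tauto.
  - tauto.
Qed.

Lemma denote_upd_same e p c : denote e (jet_upd p c (p c)) = denote e p.
Proof.
  assert (E : forall c', jet_upd p c (p c) c' = p c').
  { intros c'; unfold jet_upd; destruct (coord_eq_dec c' c); congruence. }
  induction e; simpl; unfold lift; rewrite ?E; congruence.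
Qed.

Lemma is_derive_denote e p c : jsmooth e -> inbox J X U p ->
  is_derive (fun s => denote e (jet_upd p c s)) (p c) (denote (jpartial c e) p).
Proof.
  intros He Hp.
  induction e as [f|i j|e1 IH1 e2 IH2|e1 IH1 e2 IH2|e1 IH1 e2 IH2].
  - destruct Hp as (Ht & Hx & Hu); simpl in He.
    assert (D := fun d => smooth3_ex_pd1 d f He _ _ _ Ht Hx Hu).
    destruct c as [| |[|i] [|j]]; cbn; unfold lift, jet_upd, pd1; cbn;
      try (rewrite Rminus_diag; apply (is_derive_const (V := R_NormedModule))).
    + apply Derive_correct, (D dir_t).
    + apply Derive_correct, (D dir_x).
    + apply Derive_correct, (D dir_u).
  - cbn [jpartial denote]; unfold jet_upd; destruct (coord_eq_dec (cu i j) c); cbn.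
    + apply (is_derive_id (K := R_AbsRing)).
    + rewrite Rminus_diag; apply (is_derive_const (V := R_NormedModule)).
  - destruct He; apply (is_derive_plus (V := R_NormedModule)); auto.
  - destruct He; apply (is_derive_minus (V := R_NormedModule)); auto.
  - destruct He as [He1 He2].
    generalize (is_derive_mult _ _ (p c) _ _ (IH1 He1) (IH2 He2) Rmult_comm).
    rewrite !denote_upd_same; intros H; exact H.
Qed.

Lemma total_Dx_denote e p : jsmooth e -> inbox J X U p ->
  total_Dx (denote e) p = denote (jDx e) p.
Proof.
  intros He Hp.
  assert (E : forall c, partial c (denote e) p = denote (jpartial c e) p).
  { intros c; now apply is_derive_unique, is_derive_denote. }
  unfold total_Dx; rewrite E, (sum_jet_ext 4 _ _ (fun i j => f_equal _ (E (cu i j)))).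
  clear E He Hp; unfold sum_jet; cbn -[jpartial jDx].
  induction e as [f|i j|e1 IH1 e2 IH2|e1 IH1 e2 IH2|e1 IH1 e2 IH2].
  - cbn; ring.
  - destruct i as [|[|[|[|[|i]]]]]; destruct j as [|[|[|[|[|j]]]]]; cbn; unfold lift; ring.
  - cbn [jDx denote]; rewrite <- IH1, <- IH2; cbn [jpartial denote]; ring.
  - cbn [jDx denote]; rewrite <- IH1, <- IH2; cbn [jpartial denote]; ring.
  - cbn [jDx denote]; rewrite <- IH1, <- IH2; cbn [jpartial denote]; ring.
Qed.

Fixpoint jprol (Q : vfield) (j : nat) : jterm :=
  match j with
  | O => JFun (veta Q)
  | S j' => JSub (JSub (jDx (jprol Q j')) (JMul (jDx (JFun (vtau Q))) (JVar 1 j')))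
                (JMul (jDx (JFun (vxi Q))) (JVar 0 (S j')))
  end.

Lemma jsmooth_jprol Q j : vf_smooth J X U Q -> jsmooth (jprol Q j).
Proof.
  intros (Ht & Hx & He); induction j as [|j IH]; [exact He|].
  exact (conj (conj (jsmooth_jDx _ IH) (conj (jsmooth_jDx (JFun _) Ht) I))
              (conj (jsmooth_jDx (JFun _) Hx) I)).
Qed.

Hypothesis oJ : open J.
Hypothesis oX : open X.
Hypothesis oU : open U.

Lemma prol_coef_x_denote Q j : vf_smooth J X U Q ->
  eq_on_box J X U (prol_coef_x Q j) (denote (jprol Q j)).
Proof.
  intros HQ; induction j as [|j IH]; [easy|].
  intros p Hp; cbn [jprol denote prol_coef_x].
  rewrite (total_Dx_ext J X U oJ oX oU _ _ IH p Hp).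
  rewrite total_Dx_denote by (trivial; now apply jsmooth_jprol).
  destruct HQ as (Ht & Hx & _).
  now rewrite <- (total_Dx_denote (JFun (vtau Q))), <- (total_Dx_denote (JFun (vxi Q))).
Qed.

End DifferentialPolynomials.

(** * Smoothness *)

Lemma is_derive_constR (c x : R) : is_derive (fun _ : R => c) x 0.
Proof. exact (is_derive_const (V := R_NormedModule) c x). Qed.

Lemma is_derive_idR (x : R) : is_derive (fun y : R => y) x 1.
Proof. exact (is_derive_id (K := R_AbsRing) x). Qed.

Section ElementarySmoothness.

Variables J X U : R -> Prop.
Hypothesis oJ : open J.
Hypothesis oX : open X.
Hypothesis oU : open U.

Definition box_function (f : R -> R -> R -> R) (q : R * R * R) : R :=
  f (fst (fst q)) (snd (fst q)) (snd q).

Lemma locally_box t x u : J t -> X x -> U u ->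
  locally ((t, x), u)
    (fun q : R * R * R => J (fst (fst q)) /\ X (snd (fst q)) /\ U (snd q)).
Proof.
  intros Ht Hx Hu; repeat apply filter_and.
  - apply (continuous_comp (fun q : R * R * R => fst q) fst ((t, x), u)
             (continuous_fst _ _) (continuous_fst _ _) J), oJ, Ht.
  - apply (continuous_comp (fun q : R * R * R => fst q) snd ((t, x), u)
             (continuous_fst _ _) (continuous_snd _ _) X), oX, Hx.
  - exact (continuous_snd _ _ U (oU _ Hu)).
Qed.

Lemma pd1_ext d f g : on_box J X U (fun t x u => f t x u = g t x u) ->
  on_box J X U (fun t x u => pd1 d f t x u = pd1 d g t x u).
Proof.
  intros E t x u Ht Hx Hu; destruct d; cbn; apply Derive_ext_loc.
  - generalize (oJ t Ht); apply filter_imp; intros; now apply E.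
  - generalize (oX x Hx); apply filter_imp; intros; now apply E.
  - generalize (oU u Hu); apply filter_imp; intros; now apply E.
Qed.

Lemma ex_pd1_ext d f g : on_box J X U (fun t x u => f t x u = g t x u) ->
  on_box J X U (fun t x u => ex_pd1 d f t x u -> ex_pd1 d g t x u).
Proof.
  intros E t x u Ht Hx Hu; destruct d; cbn; apply ex_derive_ext_loc.
  - generalize (oJ t Ht); apply filter_imp; intros; now apply E.
  - generalize (oX x Hx); apply filter_imp; intros; now apply E.
  - generalize (oU u Hu); apply filter_imp; intros; now apply E.
Qed.

Lemma pd_ext w f g : on_box J X U (fun t x u => f t x u = g t x u) ->
  on_box J X U (fun t x u => pd w f t x u = pd w g t x u).
Proof. intros E; induction w as [|d w IH]; [exact E | now apply pd1_ext]. Qed.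

Lemma smooth3_ext f g : on_box J X U (fun t x u => f t x u = g t x u) ->
  smooth3 J X U f -> smooth3 J X U g.
Proof.
  intros E Hf w t x u Ht Hx Hu; destruct (Hf w t x u Ht Hx Hu) as [C D]; split.
  - apply (continuous_ext_loc _ (box_function (pd w f))); [|exact C].
    generalize (locally_box t x u Ht Hx Hu); apply filter_imp.
    intros q (? & ? & ?); now apply pd_ext.
  - intros d; generalize (D d); apply ex_pd1_ext; trivial; now apply pd_ext.
Qed.

(* A class of functions closed under partial differentiation. *)
Inductive elementary : (R -> R -> R -> R) -> Prop :=
| elem_const k : elementary (fun _ _ _ => k)
| elem_x : elementary (fun _ x _ => x)
| elem_u : elementary (fun _ _ u => u)
| elem_smooth1 g : smooth1 J g -> elementary (fun t _ _ => g t)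
| elem_primitive g g' : (forall t, J t -> is_derive g t (g' t)) ->
    elementary (fun t _ _ => g' t) -> elementary (fun t _ _ => g t)
| elem_plus f g : elementary f -> elementary g ->
    elementary (fun t x u => f t x u + g t x u)
| elem_mult f g : elementary f -> elementary g ->
    elementary (fun t x u => f t x u * g t x u)
| elem_exp f : elementary f -> elementary (fun t x u => exp (f t x u)).

Definition is_pd1 (d : dir) (f : R -> R -> R -> R) (t x u l : R) : Prop :=
  match d with
  | dir_t => is_derive (fun s => f s x u) t l
  | dir_x => is_derive (fun s => f t s u) x l
  | dir_u => is_derive (fun s => f t x s) u l
  end.

(** Closure under differentiation yields derivatives of all orders from first derivatives alone. The
    constructor for primitives is there for [A] and [T], which are known only through their
    derivatives [alpha] and [exp (- A)]. *)
Lemma elementary_is_pd1 f d : elementary f ->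
  exists g, elementary g /\ on_box J X U (fun t x u => is_pd1 d f t x u (g t x u)).
Proof.
  induction 1 as [k| | |g Hg|g g' Hg Hg' _|f g Hf [f' [Ef Df]] Hg [g' [Eg Dg]]
                 |f g Hf [f' [Ef Df]] Hg [g' [Eg Dg]]|f Hf [f' [Ef Df]]].
  - exists (fun _ _ _ => 0); split; [apply elem_const|].
    intros t x u _ _ _; destruct d; cbn; apply is_derive_constR.
  - exists (fun _ _ _ => match d with dir_x => 1 | _ => 0 end); split; [apply elem_const|].
    intros t x u _ _ _; destruct d; cbn; first [apply is_derive_constR | apply is_derive_idR].
  - exists (fun _ _ _ => match d with dir_u => 1 | _ => 0 end); split; [apply elem_const|].
    intros t x u _ _ _; destruct d; cbn; first [apply is_derive_constR | apply is_derive_idR].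
  - exists (fun t _ _ => match d with dir_t => Derive g t | _ => 0 end); split.
    + destruct d; try apply elem_const.
      apply elem_smooth1; intros n t Ht.
      (* [ex_derive_n] at order 0 is [True]; at higher orders [Derive_n] of [Derive g] is
         [Derive_n g] one order up. *)
      destruct n as [|n]; [exact I|].
      apply (ex_derive_ext (Derive_n g (S n))); [|exact (Hg (S (S n)) t Ht)].
      clear; intros t; revert t; induction n as [|n IH]; intros t; [reflexivity|].
      apply Derive_ext, IH.
    + intros t x u Ht _ _; destruct d; cbn; try apply is_derive_constR.
      exact (Derive_correct _ _ (Hg 1%nat t Ht)).
  - exists (fun t _ _ => match d with dir_t => g' t | _ => 0 end); split.
    + destruct d; try apply elem_const; assumption.
    + intros t x u Ht _ _; destruct d; cbn; try apply is_derive_constR.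
      now apply Hg.
  - exists (fun t x u => f' t x u + g' t x u); split; [now apply elem_plus|].
    intros t x u Ht Hx Hu; generalize (Df t x u Ht Hx Hu) (Dg t x u Ht Hx Hu).
    destruct d; apply (is_derive_plus (V := R_NormedModule)).
  - exists (fun t x u => f' t x u * g t x u + f t x u * g' t x u); split.
    { apply elem_plus; now apply elem_mult. }
    intros t x u Ht Hx Hu; generalize (Df t x u Ht Hx Hu) (Dg t x u Ht Hx Hu).
    destruct d; intros F G; exact (is_derive_mult _ _ _ _ _ F G Rmult_comm).
  - exists (fun t x u => f' t x u * exp (f t x u)); split.
    { apply elem_mult; [assumption|now apply elem_exp]. }
    intros t x u Ht Hx Hu; generalize (Df t x u Ht Hx Hu).
    destruct d; intros F; exact (is_derive_comp exp _ _ _ _ (is_derive_exp _) F).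
Qed.

Lemma elementary_pd f w : elementary f ->
  exists g, elementary g /\ on_box J X U (fun t x u => pd w f t x u = g t x u).
Proof.
  intros Hf; induction w as [|d w (g & Hg & E)]; [now exists f|].
  destruct (elementary_is_pd1 g d Hg) as (g' & Hg' & D).
  exists g'; split; [assumption|]; intros t x u Ht Hx Hu.
  change (pd1 d (pd w f) t x u = g' t x u); rewrite (pd1_ext d _ _ E) by trivial.
  generalize (D t x u Ht Hx Hu); destruct d; apply is_derive_unique.
Qed.

Lemma elementary_continuous f t x u : elementary f -> J t ->
  continuous (box_function f) ((t, x), u).
Proof.
  intros Hf Ht.
  assert (Cg : forall g, ex_derive g t -> continuous (box_function (fun t _ _ => g t)) ((t, x), u)).
  { intros g Dg; apply (continuous_comp (fun q : R * R * R => fst (fst q)) g).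
    - apply (continuous_comp fst fst); apply continuous_fst.
    - now apply (ex_derive_continuous g). }
  induction Hf as [k| | |g Hg|g g' Hg _ _|f g _ IHf _ IHg|f g _ IHf _ IHg|f _ IHf].
  - apply continuous_const.
  - apply (continuous_comp fst snd); [apply continuous_fst | apply continuous_snd].
  - apply continuous_snd.
  - apply Cg; exact (Hg 1%nat t Ht).
  - apply Cg; eexists; now apply Hg.
  - apply (continuous_plus (V := R_NormedModule)); assumption.
  - apply (continuous_mult (K := R_AbsRing)); assumption.
  - apply (continuous_comp (box_function f) exp); [assumption|].
    apply (ex_derive_continuous exp); eexists; apply is_derive_exp.
Qed.

Lemma elementary_smooth3 f : elementary f -> smooth3 J X U f.
Proof.
  intros Hf w t x u Ht Hx Hu; destruct (elementary_pd f w Hf) as (g & Hg & E).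
  split.
  - apply (continuous_ext_loc _ (box_function g)); [|now apply elementary_continuous].
    generalize (locally_box t x u Ht Hx Hu); apply filter_imp.
    intros q (? & ? & ?); symmetry; now apply E.
  - intros d; apply (ex_pd1_ext d g); trivial.
    + intros ? ? ? ? ? ?; symmetry; now apply E.
    + destruct (elementary_is_pd1 g d Hg) as (g' & _ & D).
      generalize (D t x u Ht Hx Hu); destruct d; intros H; now exists (g' t x u).
Qed.

Lemma smooth3_smooth1 f x u : X x -> U u -> smooth3 J X U f -> smooth1 J (fun t => f t x u).
Proof.
  intros Hx Hu Hf n t Ht; destruct n as [|n]; [exact I|].
  apply (ex_derive_ext (fun t => pd (repeat dir_t n) f t x u)).
  - intros s; revert s; induction n as [|n IH]; intros s; [reflexivity|].
    now apply Derive_ext.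
  - apply (Hf (repeat dir_t n) t x u Ht Hx Hu) with (d := dir_t).
Qed.

End ElementarySmoothness.

(** * Sparse jets and single coefficients of the fifth prolongation *)

Definition jet_at (t x u u1 u4 u5 v v4 : R) : jet := fun c =>
  match c with
  | ct => t
  | cx => x
  | cu 0 0 => u
  | cu 0 1 => u1
  | cu 0 4 => u4
  | cu 0 5 => u5
  | cu 1 0 => v
  | cu 1 4 => v4
  | _ => 0
  end.

(** Each of the five steps of the recursion contributes one [- (D_x tau) u_txxxx]. In [jet_at] the
    coordinates [u_xx] and [u_xxx] are zero, which keeps the expansion short. *)
Lemma jprol_slope_u14 Q t x u u1 v v4 :
  denote (jprol Q 5) (jet_at t x u u1 0 0 v v4)
  = denote (jprol Q 5) (jet_at t x u u1 0 0 v 0)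
    - 5 * v4 * (pd1 dir_x (vtau Q) t x u + u1 * pd1 dir_u (vtau Q) t x u).
Proof.
  cbn -[pd1]; unfold lift; cbn -[pd1].
  rewrite ?Rmult_0_l, ?Rmult_0_r, ?Rplus_0_l, ?Rplus_0_r, ?Rminus_0_r,
    ?Rmult_0_r, ?Rplus_0_l, ?Rplus_0_r, ?Rminus_0_r.
  ring.
Qed.

Fixpoint jDx_iter (n : nat) (e : jterm) : jterm :=
  match n with O => e | S m => jDx (jDx_iter m e) end.

Fixpoint jprol_xi (xi eta : R -> R -> R -> R) (j : nat) : jterm :=
  match j with
  | O => JFun eta
  | S j' => JSub (jDx (jprol_xi xi eta j')) (JMul (jDx (JFun xi)) (JVar 0 (S j')))
  end.

(** The 6 is 5 + 1: five terms [- (D_x xi) u_xxxxx], and one more from the top-order part of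
    [D_x^5 xi], which multiplies [u_x]. The entries [v] and [v'] may differ because no time
    derivative of [u] survives in [jprol_xi]; this is needed since [u_t] on the equation varies with
    [u5]. *)
Lemma jprol_xi_slope_u5 xi eta t x u u1 u5 v v' :
  denote (jprol_xi xi eta 5) (jet_at t x u u1 0 u5 v 0)
  = denote (jprol_xi xi eta 5) (jet_at t x u u1 0 0 v' 0)
    + u5 * (pd1 dir_u eta t x u - 5 * pd1 dir_x xi t x u - 6 * u1 * pd1 dir_u xi t x u).
Proof.
  cbn -[pd1]; unfold lift; cbn -[pd1].
  rewrite ?Rmult_0_l, ?Rmult_0_r, ?Rplus_0_l, ?Rplus_0_r, ?Rminus_0_r,
    ?Rmult_0_r, ?Rplus_0_l, ?Rplus_0_r, ?Rminus_0_r.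
  ring.
Qed.

(** The two orders of mixed differentiation are kept apart: the first total derivative gives
    [eta_x], whose fourth derivative yields one [u]-derivative of [eta_x], and [u_x eta_u], which
    yields four [x]-derivatives of [eta_u]. *)
Lemma jDx5_slope_u4 eta t x u u1 u4 v :
  denote (jDx_iter 5 (JFun eta)) (jet_at t x u u1 u4 0 v 0)
  = denote (jDx_iter 5 (JFun eta)) (jet_at t x u u1 0 0 v 0)
    + u4 * (pd1 dir_u (pd1 dir_x eta) t x u + 4 * pd1 dir_x (pd1 dir_u eta) t x u
            + 5 * u1 * pd1 dir_u (pd1 dir_u eta) t x u).
Proof.
  cbn -[pd1]; unfold lift; cbn -[pd1].
  rewrite ?Rmult_0_l, ?Rmult_0_r, ?Rplus_0_l, ?Rplus_0_r, ?Rminus_0_r,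
    ?Rmult_0_r, ?Rplus_0_l, ?Rplus_0_r, ?Rminus_0_r.
  ring.
Qed.

(** * Determining equations *)

Lemma constant_of_derive0 (J : R -> Prop) (f : R -> R) :
  nonempty_open_interval J -> (forall t, J t -> is_derive f t 0) ->
  forall s t, J s -> J t -> f s = f t.
Proof.
  intros (_ & cJ & _) Df.
  assert (E : forall s t, J s -> J t -> s < t -> f s = f t).
  { intros s t Hs Ht Hst; apply (eq_is_derive f s t); trivial.
    intros r Hr; apply Df, (cJ s t r); trivial. }
  intros s t Hs Ht; destruct (Rtotal_order s t) as [L|[->|L]]; [now apply E|trivial|].
  symmetry; now apply E.
Qed.

Lemma affine_zero_on_interval (V : R -> Prop) a b : nonempty_open_interval V ->
  (forall x, V x -> a * x + b = 0) -> a = 0 /\ b = 0.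
Proof.
  intros (oV & _ & v & Hv) E.
  destruct (oV v Hv) as [eps He].
  assert (Hv' : V (v + eps / 2)).
  { apply He; unfold ball; cbn; unfold AbsRing_ball, abs, minus, plus, opp; cbn.
    rewrite Rabs_pos_eq; generalize (cond_pos eps); lra. }
  assert (E1 := E _ Hv); assert (E2 := E _ Hv'); generalize (cond_pos eps); intros P.
  assert (a * (eps / 2) = 0) by lra.
  assert (a = 0) by (apply Rmult_integral in H; destruct H; lra).
  subst a; lra.
Qed.

Section Invariance.

Variables J X U : R -> Prop.
Hypothesis hJ : nonempty_open_interval J.
Hypothesis hX : nonempty_open_interval X.
Hypothesis hU : nonempty_open_interval U.

Let oJ : open J := proj1 hJ.
Let oX : open X := proj1 hX.
Let oU : open U := proj1 hU.

Lemma pd1_x_zero_constant f : smooth3 J X U f ->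
  on_box J X U (fun t x u => pd1 dir_x f t x u = 0) ->
  forall x', X x' -> on_box J X U (fun t x u => f t x u = f t x' u).
Proof.
  intros Hf E x' Hx' t x u Ht Hx Hu.
  apply (constant_of_derive0 X (fun s => f t s u)); trivial.
  intros s Hs; rewrite <- (E t s u Ht Hs Hu).
  apply Derive_correct, (smooth3_ex_pd1 J X U dir_x f Hf t s u Ht Hs Hu).
Qed.

Lemma pd1_u_zero_constant f : smooth3 J X U f ->
  on_box J X U (fun t x u => pd1 dir_u f t x u = 0) ->
  forall u', U u' -> on_box J X U (fun t x u => f t x u = f t x u').
Proof.
  intros Hf E u' Hu' t x u Ht Hx Hu.
  apply (constant_of_derive0 U (fun s => f t x s)); trivial.
  intros s Hs; rewrite <- (E t x s Ht Hx Hs).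
  apply Derive_correct, (smooth3_ex_pd1 J X U dir_u f Hf t x s Ht Hx Hs).
Qed.

Lemma pd1_const d k t x u : pd1 d (fun _ _ _ => k) t x u = 0.
Proof. destruct d; cbn; apply Derive_const. Qed.

(** With [D_x tau = 0] and [D_x xi = h(t)] every step of the recursion subtracts one [h u_j], so
    that beyond this multiple of [u_j] only the total derivatives of [eta] remain. *)
Lemma prol_coef_x_dilation Q h j : vf_smooth J X U Q ->
  on_box J X U (fun t x u => pd1 dir_x (vtau Q) t x u = 0) ->
  on_box J X U (fun t x u => pd1 dir_u (vtau Q) t x u = 0) ->
  on_box J X U (fun t x u => pd1 dir_x (vxi Q) t x u = h t) ->
  on_box J X U (fun t x u => pd1 dir_u (vxi Q) t x u = 0) ->
  (j <= 5)%nat ->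
  eq_on_box J X U (prol_coef_x Q j)
    (fun p => denote (jDx_iter j (JFun (veta Q))) p - INR j * h (p ct) * p (cu 0 j)).
Proof.
  intros HQ Tx Tu Xx Xu.
  assert (sh : smooth3 J X U (pd1 dir_x (vxi Q))) by apply smooth3_pd1, HQ.
  assert (sD : forall i, jsmooth J X U (jDx_iter i (JFun (veta Q)))).
  { induction i as [|i IH]; [apply HQ | now apply jsmooth_jDx]. }
  induction j as [|j IH]; intros Hj p Hp.
  { cbn; ring. }
  cbn [prol_coef_x].
  (* In the symbolic term [h] is represented by [pd1 dir_x (vxi Q)], whose smoothness is known; [h]
     itself is only a name for its values. *)
  set (e := JSub (jDx_iter j (JFun (veta Q)))
      (JMul (JMul (JFun (fun _ _ _ => INR j)) (JFun (pd1 dir_x (vxi Q)))) (JVar 0 j))).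
  rewrite (total_Dx_ext J X U oJ oX oU (prol_coef_x Q j) (denote e)); [| |exact Hp].
  2:{ intros q Hq; rewrite IH by (trivial; lia); unfold e; cbn [denote]; unfold lift.
      destruct Hq as (? & ? & ?); now rewrite Xx. }
  rewrite (total_Dx_denote J X U); [| |exact Hp].
  2:{ refine (conj (sD j) (conj (conj _ sh) I)).
      apply elementary_smooth3; trivial; apply elem_const. }
  rewrite !total_Dx_lift; unfold e; cbn [jDx denote jDx_iter].
  replace (Nat.leb (0 + j) 4) with true by (symmetry; apply Nat.leb_le; lia).
  cbn [denote]; unfold lift; destruct Hp as (Ht & Hx & Hu).
  rewrite Tx, Tu, Xu, Xx, !pd1_const by trivial.
  rewrite (pd1_ext J X U oJ oX oU dir_x _ _ Xx) by trivial.
  rewrite (pd1_ext J X U oJ oX oU dir_u _ _ Xx) by trivial.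
  replace (pd1 dir_x (fun t _ _ : R => h t) (p ct) (p cx) (p (cu 0 0))) with 0
    by (symmetry; cbn; apply Derive_const).
  replace (pd1 dir_u (fun t _ _ : R => h t) (p ct) (p cx) (p (cu 0 0))) with 0
    by (symmetry; cbn; apply Derive_const).
  rewrite S_INR; ring.
Qed.

Lemma prol_coef_x_no_tau Q j : vf_smooth J X U Q ->
  on_box J X U (fun t x u => pd1 dir_x (vtau Q) t x u = 0) ->
  on_box J X U (fun t x u => pd1 dir_u (vtau Q) t x u = 0) ->
  eq_on_box J X U (prol_coef_x Q j) (denote (jprol_xi (vxi Q) (veta Q) j)).
Proof.
  intros HQ Tx Tu.
  assert (sm : forall i, jsmooth J X U (jprol_xi (vxi Q) (veta Q) i)).
  { induction i as [|i IH]; [apply HQ|].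
    refine (conj (jsmooth_jDx _ _ _ _ IH) (conj (jsmooth_jDx _ _ _ (JFun _) _) I)).
    apply HQ. }
  induction j as [|j IH]; intros p Hp; [easy|].
  cbn [prol_coef_x].
  rewrite (total_Dx_ext J X U oJ oX oU _ _ IH) by exact Hp.
  rewrite (total_Dx_denote J X U) by trivial.
  rewrite !total_Dx_lift; destruct Hp as (Ht & Hx & Hu).
  unfold lift at 1 2; rewrite Tx, Tu by trivial; cbn [jprol_xi denote jDx]; ring.
Qed.

(** For a field affine in this way the recursion closes in elementary form. The coefficient
    functions come with no regularity, so the computation is made on [partial] directly instead of
    on terms. *)
Lemma prol_coef_x_affine Q tau xi h a g x0 u0 j :
  vf_eq J X U Q (VF (fun t _ _ => tau t) (fun t x _ => h t * (x - x0) + xi t)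
                    (fun t x u => a t * (u - u0) + g t x)) ->
  (j <= 4)%nat ->
  eq_on_box J X U (prol_coef_x Q (S j))
    (fun p => (a (p ct) - INR (S j) * h (p ct)) * p (cu 0 (S j))
              + Derive_n (g (p ct)) (S j) (p cx)).
Proof.
  intros EQ.
  (* No differentiability of [f] is required: the difference quotients are equal. *)
  assert (DP : forall f k x, Derive (fun s => k + f s) x = Derive f x).
  { intros f k x; unfold Derive; f_equal; apply Lim_ext; intros y; f_equal; ring. }
  assert (DQ : forall f k l x, Derive (fun s => k * (l + s) + f) x = k).
  { intros f k l x; apply is_derive_unique; auto_derive; [trivial|ring]. }
  assert (Step : forall i (b : R -> R) w0 (f : R -> R -> R) p, (i <= 4)%nat ->
    total_Dx (fun p => b (p ct) * (p (cu 0 i) - w0) + f (p ct) (p cx)) p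
    = b (p ct) * p (cu 0 (S i)) + Derive (f (p ct)) (p cx)).
  { intros i b w0 f p Hi.
    assert (E : forall c, partial c (fun p => b (p ct) * (p (cu 0 i) - w0) + f (p ct) (p cx)) p =
      match c with
      (* Left unevaluated, since [total_Dx] never asks for the time derivative. *)
      | ct => partial ct (fun p => b (p ct) * (p (cu 0 i) - w0) + f (p ct) (p cx)) p
      | cx => Derive (f (p ct)) (p cx)
      | cu i' j' => if coord_eq_dec (cu 0 i) (cu i' j') then b (p ct) else 0
      end).
    { intros [| |i' j']; [reflexivity| |]; unfold partial, jet_upd.
      - cbn; apply DP.
      - destruct (coord_eq_dec (cu 0 i) (cu i' j')).
        + cbn; apply is_derive_unique; auto_derive; [trivial|ring].
        + cbn; apply Derive_const. }
    unfold total_Dx, sum_jet; cbn -[partial coord_eq_dec]; rewrite !E.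
    destruct i as [|[|[|[|[|i]]]]]; [| | | | |lia]; cbn; ring. }
  assert (TD : eq_on_box J X U (total_Dx (lift (vtau Q))) (fun _ => 0)).
  { intros p Hp; rewrite (total_Dx_ext J X U oJ oX oU _ (lift (fun t _ _ => tau t))).
    - rewrite total_Dx_lift; unfold lift, pd1; rewrite !Derive_const; ring.
    - apply lift_ext; intros ? ? ? ? ? ?; now apply EQ.
    - exact Hp. }
  assert (XD : eq_on_box J X U (total_Dx (lift (vxi Q))) (fun p => h (p ct))).
  { intros p Hp; rewrite (total_Dx_ext J X U oJ oX oU _ (lift (fun t x _ => h t * (x - x0) + xi t))).
    - rewrite total_Dx_lift; unfold lift, pd1; rewrite Derive_const.
      replace (Derive _ (p cx)) with (h (p ct)); [ring|].
      symmetry; apply is_derive_unique; auto_derive; [trivial|ring].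
    - apply lift_ext; intros ? ? ? ? ? ?; now apply EQ.
    - exact Hp. }
  induction j as [|j IH]; intros Hj p Hp; cbn [prol_coef_x]; rewrite TD, XD by exact Hp.
  - rewrite (total_Dx_ext J X U oJ oX oU _
      (fun p => a (p ct) * (p (cu 0 0) - u0) + g (p ct) (p cx))); [| |exact Hp].
    + rewrite Step by lia; cbn [INR].
      change (Derive_n (g (p ct)) 1 (p cx)) with (Derive (g (p ct)) (p cx)); ring.
    + intros q (? & ? & ?); now apply EQ.
  - change (fun p0 : jet => total_Dx (prol_coef_x Q j) p0 - total_Dx (lift (vtau Q)) p0 * p0 (cu 1 j)
         - total_Dx (lift (vxi Q)) p0 * p0 (cu 0 (S j))) with (prol_coef_x Q (S j)).
    (* The offset [w0] of [Step] is [u0] only at order 0; from here on it is 0. *)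
    rewrite (total_Dx_ext J X U oJ oX oU _
      (fun p => (fun t => a t - INR (S j) * h t) (p ct) * (p (cu 0 (S j)) - 0)
                + (fun t => Derive_n (g t) (S j)) (p ct) (p cx))); [| |exact Hp].
    + rewrite (Step (S j) (fun t => a t - INR (S j) * h t) 0
        (fun t => Derive_n (g t) (S j))) by lia; rewrite (S_INR (S j)).
      change (Derive_n (g (p ct)) (S (S j)) (p cx))
        with (Derive (Derive_n (g (p ct)) (S j)) (p cx)); ring.
    + intros q Hq; rewrite IH by (trivial; lia); rewrite Rminus_0_r; reflexivity.
Qed.

Section Determining.

Variables alpha beta : R -> R.
Hypothesis halpha : smooth1 J alpha.
Hypothesis hbeta : admissible J beta.
Variable Q : vfield.
Hypothesis HQ : Amax J X U alpha beta Q.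

Let sQ : vf_smooth J X U Q := proj1 HQ.

Lemma inbox_jet_at t x u u1 u4 u5 v v4 : J t -> X x -> U u ->
  inbox J X U (jet_at t x u u1 u4 u5 v v4).
Proof. now repeat split. Qed.

(** The value [v] solves the equation for [u_t], so all other entries of the jet are free. The
    determining equations come from subtracting two instances that differ in a single free entry. *)
Lemma invariance_at t x u u1 u4 u5 v4 : J t -> X x -> U u ->
  let v := - (u * u1 + alpha t * u + beta t * u5) in
  let D d g := pd1 d g t x u in
  vtau Q t x u * (Derive alpha t * u + Derive beta t * u5)
  + veta Q t x u * (u1 + alpha t)
  + u * (D dir_x (veta Q) + u1 * D dir_u (veta Q)
         - (D dir_x (vtau Q) + u1 * D dir_u (vtau Q)) * v
         - (D dir_x (vxi Q) + u1 * D dir_u (vxi Q)) * u1)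
  + (D dir_t (veta Q) + v * D dir_u (veta Q)
         - (D dir_t (vtau Q) + v * D dir_u (vtau Q)) * v
         - (D dir_t (vxi Q) + v * D dir_u (vxi Q)) * u1)
  + beta t * prol_coef_x Q 5 (jet_at t x u u1 u4 u5 v v4) = 0.
Proof.
  intros Ht Hx Hu v D.
  assert (E := proj2 HQ (jet_at t x u u1 u4 u5 v v4) Ht Hx Hu).
  rewrite prolong5_eqn_lhs in E.
  - apply E; unfold eqn_lhs, v; cbn; ring.
  - exact (halpha 1%nat t Ht).
  - exact (proj1 hbeta 1%nat t Ht).
Qed.

Lemma tau_time_only :
  on_box J X U (fun t x u => pd1 dir_x (vtau Q) t x u = 0)
  /\ on_box J X U (fun t x u => pd1 dir_u (vtau Q) t x u = 0).
Proof.
  assert (K : forall u1, on_box J X U (fun t x u =>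
            pd1 dir_x (vtau Q) t x u + u1 * pd1 dir_u (vtau Q) t x u = 0)).
  { intros u1 t x u Ht Hx Hu.
    assert (E1 := invariance_at t x u u1 0 0 1 Ht Hx Hu).
    assert (E0 := invariance_at t x u u1 0 0 0 Ht Hx Hu).
    cbv zeta in E1, E0.
    rewrite (prol_coef_x_denote J X U oJ oX oU Q 5 sQ _ (inbox_jet_at _ _ _ _ _ _ _ _ Ht Hx Hu)) in E1.
    rewrite (prol_coef_x_denote J X U oJ oX oU Q 5 sQ _ (inbox_jet_at _ _ _ _ _ _ _ _ Ht Hx Hu)) in E0.
    rewrite jprol_slope_u14 in E1.
    apply (Rmult_eq_reg_l (beta t)); [|now apply hbeta]; lra. }
  split; intros t x u Ht Hx Hu; generalize (K 0 t x u Ht Hx Hu) (K 1 t x u Ht Hx Hu); lra.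
Qed.

(** The coordinate [u5] enters twice, through the fifth coefficient and through [u_t]. The
    [eta_u u_t] of the time derivative cancels [beta eta_u u5], so [eta] drops out, and
    [xi_u u_t u_x] reduces the coefficient 6 of [u_x xi_u] to 5. *)
Lemma xi_u_zero_and_dilation :
  on_box J X U (fun t x u => pd1 dir_u (vxi Q) t x u = 0)
  /\ on_box J X U (fun t x u => 5 * beta t * pd1 dir_x (vxi Q) t x u
       = vtau Q t x u * Derive beta t + beta t * pd1 dir_t (vtau Q) t x u).
Proof.
  destruct tau_time_only as [Tx Tu].
  assert (K : forall u1, on_box J X U (fun t x u =>
      vtau Q t x u * Derive beta t + beta t * pd1 dir_t (vtau Q) t x u
      - 5 * beta t * pd1 dir_x (vxi Q) t x u
      - 5 * beta t * u1 * pd1 dir_u (vxi Q) t x u = 0)).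
  { intros u1 t x u Ht Hx Hu.
    assert (E1 := invariance_at t x u u1 0 1 0 Ht Hx Hu).
    assert (E0 := invariance_at t x u u1 0 0 0 Ht Hx Hu).
    cbv zeta in E1, E0.
    rewrite (prol_coef_x_no_tau Q 5 sQ Tx Tu _ (inbox_jet_at _ _ _ _ _ _ _ _ Ht Hx Hu)) in E1.
    rewrite (prol_coef_x_no_tau Q 5 sQ Tx Tu _ (inbox_jet_at _ _ _ _ _ _ _ _ Ht Hx Hu)) in E0.
    rewrite Tx, Tu in E1, E0 by trivial.
    rewrite (jprol_xi_slope_u5 _ _ _ _ _ _ _ _ (- (u * u1 + alpha t * u + beta t * 0))) in E1.
    lra. }
  split; intros t x u Ht Hx Hu; generalize (K 0 t x u Ht Hx Hu) (K 1 t x u Ht Hx Hu).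
  - intros E0 E1; apply (Rmult_eq_reg_l (beta t)); [|now apply hbeta]; lra.
  - lra.
Qed.

Variables x0 u0 : R.
Hypothesis Hx0 : X x0.
Hypothesis Hu0 : U u0.

Let tau t := vtau Q t x0 u0.
Let h t := pd1 dir_x (vxi Q) t x0 u0.
Let xi t := vxi Q t x0 u0.

Lemma tau_form : on_box J X U (fun t x u => vtau Q t x u = tau t).
Proof.
  destruct tau_time_only as [Tx Tu]; destruct sQ as (st & _).
  intros t x u Ht Hx Hu.
  rewrite (pd1_x_zero_constant _ st Tx x0) by trivial.
  now apply (pd1_u_zero_constant _ st Tu u0).
Qed.

(** The dilation identity expresses [xi_x] through [beta] and [tau], which depend on [t] alone. *)
Lemma xi_x_form : on_box J X U (fun t x u => pd1 dir_x (vxi Q) t x u = h t).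
Proof.
  destruct xi_u_zero_and_dilation as [_ E].
  intros t x u Ht Hx Hu; apply (Rmult_eq_reg_l (5 * beta t)).
  - unfold h; rewrite !E by trivial.
    rewrite !(pd1_ext J X U oJ oX oU dir_t _ _ tau_form) by trivial.
    now rewrite !tau_form.
  - apply Rmult_integral_contrapositive_currified; [lra | now apply hbeta].
Qed.

Lemma xi_form : on_box J X U (fun t x u => vxi Q t x u = h t * (x - x0) + xi t).
Proof.
  destruct xi_u_zero_and_dilation as [Xu _]; destruct sQ as (_ & sx & _).
  intros t x u Ht Hx Hu; rewrite (pd1_u_zero_constant _ sx Xu u0) by trivial.
  assert (D : forall s, X s -> is_derive (fun s => vxi Q t s u0 - h t * (s - x0)) s 0).
  { intros s Hs; replace 0 with (h t - h t) by ring.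
    apply (is_derive_minus (V := R_NormedModule)).
    - rewrite <- (xi_x_form t s u0 Ht Hs Hu0).
      apply Derive_correct, (smooth3_ex_pd1 J X U dir_x _ sx t s u0 Ht Hs Hu0).
    - auto_derive; [trivial|ring]. }
  generalize (constant_of_derive0 X _ hX D x x0 Hx Hx0); unfold xi; lra.
Qed.

Lemma eta_uu_and_ux :
  on_box J X U (fun t x u => pd1 dir_u (pd1 dir_u (veta Q)) t x u = 0)
  /\ on_box J X U (fun t x u => pd1 dir_u (pd1 dir_x (veta Q)) t x u
                                + 4 * pd1 dir_x (pd1 dir_u (veta Q)) t x u = 0).
Proof.
  destruct tau_time_only as [Tx Tu]; destruct xi_u_zero_and_dilation as [Xu _].
  assert (K : forall u1, on_box J X U (fun t x u =>
            pd1 dir_u (pd1 dir_x (veta Q)) t x u + 4 * pd1 dir_x (pd1 dir_u (veta Q)) t x u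
            + 5 * u1 * pd1 dir_u (pd1 dir_u (veta Q)) t x u = 0)).
  { intros u1 t x u Ht Hx Hu.
    assert (E1 := invariance_at t x u u1 1 0 0 Ht Hx Hu).
    assert (E0 := invariance_at t x u u1 0 0 0 Ht Hx Hu).
    cbv zeta in E1, E0.
    rewrite (prol_coef_x_dilation Q h 5 sQ Tx Tu xi_x_form Xu (le_n 5) _ (inbox_jet_at _ _ _ _ _ _ _ _ Ht Hx Hu))
      in E1.
    rewrite (prol_coef_x_dilation Q h 5 sQ Tx Tu xi_x_form Xu (le_n 5) _ (inbox_jet_at _ _ _ _ _ _ _ _ Ht Hx Hu))
      in E0.
    rewrite jDx5_slope_u4 in E1; cbn [jet_at] in E1, E0.
    apply (Rmult_eq_reg_l (beta t)); [|now apply hbeta]; lra. }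
  split; intros t x u Ht Hx Hu; generalize (K 0 t x u Ht Hx Hu) (K 1 t x u Ht Hx Hu); lra.
Qed.

Let a t := pd1 dir_u (veta Q) t x0 u0.
Let g t x := veta Q t x u0.

Lemma eta_affine_in_u : on_box J X U (fun t x u =>
  veta Q t x u = pd1 dir_u (veta Q) t x u0 * (u - u0) + g t x).
Proof.
  destruct eta_uu_and_ux as [Euu _]; destruct sQ as (_ & _ & se).
  intros t x u Ht Hx Hu.
  set (k := pd1 dir_u (veta Q) t x u0).
  assert (D : forall s, U s -> is_derive (fun s => veta Q t x s - k * (s - u0)) s 0).
  { intros s Hs; replace 0 with (k - k) by ring.
    apply (is_derive_minus (V := R_NormedModule)).
    - unfold k; rewrite (pd1_u_zero_constant _ (smooth3_pd1 _ _ _ dir_u _ se) Euu s) by trivial.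
      apply Derive_correct, (smooth3_ex_pd1 J X U dir_u _ se t x s Ht Hx Hs).
    - auto_derive; [trivial|ring]. }
  generalize (constant_of_derive0 U _ hU D u u0 Hu Hu0); unfold g; lra.
Qed.

(* The coefficient of [u4] involves both mixed second derivatives; they agree
   by the explicit form of [eta], without Schwarz's theorem. *)
Lemma eta_form : on_box J X U (fun t x u => veta Q t x u = a t * (u - u0) + g t x).
Proof.
  destruct eta_uu_and_ux as [Euu Eux]; destruct sQ as (_ & _ & se).
  intros t x u Ht Hx Hu; rewrite eta_affine_in_u by trivial; do 2 f_equal.
  apply (constant_of_derive0 X (fun s => pd1 dir_u (veta Q) t s u0)); trivial.
  intros s Hs.
  assert (Ds := smooth3_ex_pd1 J X U dir_x _ (smooth3_pd1 _ _ _ dir_u _ se) t s u0 Ht Hs Hu0).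
  assert (Dg := smooth3_ex_pd1 J X U dir_x _ se t s u0 Ht Hs Hu0).
  cbn [ex_pd1] in Ds, Dg.
  replace 0 with (pd1 dir_x (pd1 dir_u (veta Q)) t s u0); [now apply Derive_correct|].
  assert (E : pd1 dir_u (pd1 dir_x (veta Q)) t s u0 = pd1 dir_x (pd1 dir_u (veta Q)) t s u0).
  { transitivity (Derive (fun r => pd1 dir_x (pd1 dir_u (veta Q)) t s u0 * (r - u0)
                                   + pd1 dir_x (veta Q) t s u0) u0).
    - apply (pd1_ext J X U oJ oX oU dir_u _ (fun t s r => pd1 dir_x (pd1 dir_u (veta Q)) t s u0 * (r - u0)
                                   + pd1 dir_x (veta Q) t s u0)); trivial.
      clear s Hs Ds Dg t x u Ht Hx Hu; intros t s r Ht Hs Hr.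
      assert (Ds := smooth3_ex_pd1 J X U dir_x _ (smooth3_pd1 _ _ _ dir_u _ se) t s u0 Ht Hs Hu0).
      assert (Dg := smooth3_ex_pd1 J X U dir_x _ se t s u0 Ht Hs Hu0).
      rewrite (pd1_ext J X U oJ oX oU dir_x _ _ eta_affine_in_u) by trivial.
      cbn [pd1 ex_pd1] in *; unfold g; apply is_derive_unique.
      apply (is_derive_plus (V := R_NormedModule)).
      + rewrite Rmult_comm.
        apply (is_derive_ext (fun s => (r - u0) * pd1 dir_u (veta Q) t s u0)).
        { intros; cbn; ring. }
        now apply is_derive_scal, Derive_correct.
      + now apply Derive_correct.
    - generalize (pd1 dir_x (pd1 dir_u (veta Q)) t s u0) (pd1 dir_x (veta Q) t s u0).
      intros k l; apply is_derive_unique; auto_derive; [trivial|ring]. }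
  generalize (Eux t s u0 Ht Hs Hu0); rewrite E; lra.
Qed.

(** In the [u_x]-coefficient the term [u eta_u] from [u D_x eta] is cancelled by [eta_u u_t], and
    [eta] remains undifferentiated; the relation can be solved for it. The fifth coefficient does
    not see [u_x]. *)
Lemma eta_determined : on_box J X U (fun t x u =>
  veta Q t x u = (h t - Derive tau t) * u + (Derive h t * (x - x0) + Derive xi t)).
Proof.
  destruct tau_time_only as [Tx Tu]; destruct xi_u_zero_and_dilation as [Xu _].
  intros t x u Ht Hx Hu.
  assert (E1 := invariance_at t x u 1 0 0 0 Ht Hx Hu).
  assert (E0 := invariance_at t x u 0 0 0 0 Ht Hx Hu).
  cbv zeta in E1, E0.
  assert (EQ : vf_eq J X U Q (VF (fun t _ _ => tau t) (fun t x _ => h t * (x - x0) + xi t)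
                                 (fun t x u => a t * (u - u0) + g t x))).
  { intros t' x' u' ? ? ?; repeat split; [now apply tau_form|now apply xi_form|now apply eta_form]. }
  rewrite (prol_coef_x_affine Q _ _ _ _ _ _ _ 4 EQ (le_n 4) _ (inbox_jet_at _ _ _ _ _ _ _ _ Ht Hx Hu))
    in E1.
  rewrite (prol_coef_x_affine Q _ _ _ _ _ _ _ 4 EQ (le_n 4) _ (inbox_jet_at _ _ _ _ _ _ _ _ Ht Hx Hu))
    in E0.
  cbn [jet_at] in E1, E0.
  rewrite Tx, Tu, Xu, xi_x_form in E1, E0 by trivial.
  rewrite (pd1_ext J X U oJ oX oU dir_t _ _ tau_form) in E1, E0 by trivial.
  change (pd1 dir_t (fun t _ _ => tau t) t x u) with (Derive tau t) in E1, E0.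
  rewrite (pd1_ext J X U oJ oX oU dir_t _ _ xi_form) in E1, E0 by trivial.
  replace (Derive h t * (x - x0) + Derive xi t)
    with (pd1 dir_t (fun t x _ => h t * (x - x0) + xi t) t x u); [lra|].
  destruct sQ as (_ & sx & _); cbn [pd1]; apply is_derive_unique.
  apply (is_derive_plus (V := R_NormedModule)).
  - apply (is_derive_ext (fun s => (x - x0) * h s)); [intros; cbn; ring|].
    rewrite Rmult_comm; apply is_derive_scal, Derive_correct.
    apply (smooth3_ex_pd1 J X U dir_t _ (smooth3_pd1 _ _ _ dir_x _ sx) t x0 u0 Ht Hx0 Hu0).
  - apply Derive_correct, (smooth3_ex_pd1 J X U dir_t _ sx t x0 u0 Ht Hx0 Hu0).
Qed.

End Determining.

Definition reduced_field (x0 : R) (tau h xi : R -> R) : vfield :=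
  VF (fun t _ _ => tau t) (fun t x _ => h t * (x - x0) + xi t)
     (fun t x u => (h t - Derive tau t) * u + (Derive h t * (x - x0) + Derive xi t)).

(** On the equation the criterion is affine in [u5], [u] and [x], with coefficients depending on [t]
    alone. This one identity serves both directions: reading off the ODEs and verifying that a given
    field is a symmetry. *)
Lemma prolong5_reduced_field alpha beta Q x0 tau h xi p :
  smooth1 J alpha -> smooth1 J beta -> smooth1 J tau -> smooth1 J h -> smooth1 J xi ->
  vf_eq J X U Q (reduced_field x0 tau h xi) ->
  inbox J X U p -> eqn_lhs alpha beta p = 0 ->
  let t := p ct in
  prolong5 Q (eqn_lhs alpha beta) p =
  p (cu 0 5) * (tau t * Derive beta t + beta t * Derive tau t - 5 * beta t * h t)
  + p (cu 0 0) * (tau t * Derive alpha t + alpha t * Derive tau t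
                  + 2 * Derive h t - Derive_n tau 2 t)
  + (p cx - x0) * (alpha t * Derive h t + Derive_n h 2 t)
  + (alpha t * Derive xi t + Derive_n xi 2 t).
Proof.
  intros sa sb st sh sx EQ Hp HL t.
  assert (Hpt : J t) by apply Hp.
  set (k := Derive h t); set (l := Derive xi t).
  assert (A2 : forall n x, Derive_n (fun x => k * (x - x0) + l) (S (S n)) x = 0).
  { induction n as [|n IH]; intros x.
    - cbn; rewrite (Derive_ext _ (fun _ => k)); [apply Derive_const|].
      intros s; apply is_derive_unique; auto_derive; [trivial|ring].
    - change (Derive (Derive_n (fun x => k * (x - x0) + l) (S (S n))) x = 0).
      rewrite (Derive_ext _ (fun _ => 0)) by apply IH; apply Derive_const. }
  rewrite prolong5_eqn_lhs by (apply (sa 1%nat) || apply (sb 1%nat); trivial).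
  cbv zeta.
  rewrite (prol_coef_x_affine Q tau xi h (fun t => h t - Derive tau t)
             (fun t x => Derive h t * (x - x0) + Derive xi t) x0 0 4); [|  |lia|exact Hp].
  2:{ intros ? ? u Ht Hx Hu; cbn; rewrite (Rminus_0_r u); now apply EQ. }
  fold t k l; rewrite A2.
  assert (PT := fun d => pd1_ext J X U oJ oX oU d (vtau Q) _ (fun t x u Ht Hx Hu => proj1 (EQ t x u Ht Hx Hu))).
  assert (PX := fun d => pd1_ext J X U oJ oX oU d (vxi Q) _ (fun t x u Ht Hx Hu => proj1 (proj2 (EQ t x u Ht Hx Hu)))).
  assert (PE := fun d => pd1_ext J X U oJ oX oU d (veta Q) _ (fun t x u Ht Hx Hu => proj2 (proj2 (EQ t x u Ht Hx Hu)))).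
  destruct Hp as (Ht & Hx & Hu); unfold lift.
  destruct (EQ _ _ _ Ht Hx Hu) as (-> & _ & ->).
  rewrite !PT, !PX, !PE by trivial; clear PT PX PE.
  cbn [vtau vxi veta reduced_field pd1]; fold t.
  set (x := p cx); set (u := p (cu 0 0)).
  rewrite !Derive_const.
  replace (Derive (fun s => h t * (s - x0) + xi t) x) with (h t)
    by (symmetry; apply is_derive_unique; auto_derive; [trivial|ring]).
  replace (Derive (fun s => h s * (x - x0) + xi s) t) with (k * (x - x0) + l).
  2:{ symmetry; apply is_derive_unique; unfold k, l.
      generalize (sh 1%nat t Hpt) (sx 1%nat t Hpt); cbn; intros.
      auto_derive; [now repeat split|].
      change (fun x => h x) with h; change (fun x => xi x) with xi; ring. }
  replace (Derive (fun s => (h t - Derive tau t) * u + (Derive h t * (s - x0) + Derive xi t)) x)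
    with k.
  2:{ fold k l; symmetry; apply is_derive_unique; auto_derive; [trivial|ring]. }
  replace (Derive (fun s => (h t - Derive tau t) * s + (Derive h t * (x - x0) + Derive xi t)) u)
    with (h t - Derive tau t).
  2:{ fold k l; symmetry; apply is_derive_unique; auto_derive; [trivial|ring]. }
  replace (Derive (fun s => (h s - Derive tau s) * u + (Derive h s * (x - x0) + Derive xi s)) t)
    with ((k - Derive_n tau 2 t) * u + (Derive_n h 2 t * (x - x0) + Derive_n xi 2 t)).
  2:{ symmetry; apply is_derive_unique; unfold k.
      generalize (sh 1%nat t Hpt) (sh 2%nat t Hpt) (sx 2%nat t Hpt) (st 2%nat t Hpt); intros.
      generalize (Derive_correct _ _ H) (Derive_correct _ _ H0) (Derive_correct _ _ H1) (Derive_correct _ _ H2).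
      clear; intros D1 D2 D3 D4.
      apply (is_derive_plus (V := R_NormedModule)).
      - apply (is_derive_ext (fun s => u * (h s - Derive tau s))); [intros; cbn; ring|].
        rewrite Rmult_comm; apply is_derive_scal, (is_derive_minus (V := R_NormedModule)); assumption.
      - apply (is_derive_plus (V := R_NormedModule)); [|assumption].
        apply (is_derive_ext (fun s => (x - x0) * Derive h s)); [intros; cbn; ring|].
        rewrite Rmult_comm; now apply is_derive_scal. }
  replace (p (cu 1 0)) with (- (u * p (cu 0 1) + alpha t * u + beta t * p (cu 0 5)))
    by (unfold eqn_lhs in HL; fold t u in HL; lra).
  change (fun s => tau s) with tau; fold k l; cbn [INR]; ring.
Qed.

End Invariance.

(** * Normal form of the symmetries *)

Section NormalForm.

Variables J X U : R -> Prop.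
Hypothesis hJ : nonempty_open_interval J.
Hypothesis hX : nonempty_open_interval X.
Hypothesis hU : nonempty_open_interval U.
Variables alpha A T : R -> R.
Hypothesis halpha : smooth1 J alpha.
Hypothesis hA : forall t, J t -> is_derive A t (alpha t).
Hypothesis hT : forall t, J t -> is_derive T t (exp (- A t)).

Let oJ : open J := proj1 hJ.
Let oX : open X := proj1 hX.
Let oU : open U := proj1 hU.

Definition quadratic (k l n t : R) : R := k * T t ^ 2 + l * T t + n.

Definition normal_field (k l n m p q : R) : vfield :=
  VF (fun t _ _ => exp (A t) * quadratic k l n t)
     (fun t x _ => (k * T t + m) * x + (p * T t + q))
     (fun t x u => (m - l - k * T t - alpha t * (exp (A t) * quadratic k l n t)) * u
                   + exp (- A t) * (k * x + p)).

(* With [beta = T_t g], this is the logarithmic derivative of [g] with respect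
   to [T]. *)
Definition log_slope (beta : R -> R) (t : R) : R :=
  exp (A t) * (Derive beta t / beta t + alpha t).

Definition classifying (beta : R -> R) (k l n m : R) : Prop :=
  forall t, J t -> quadratic k l n t * log_slope beta t = 3 * k * T t + 5 * m - l.

Lemma exp_A_inv t : exp (A t) * exp (- A t) = 1.
Proof. rewrite <- exp_plus, Rplus_opp_r; apply exp_0. Qed.

(* [auto_derive] leaves the functions eta-expanded, which [rewrite] does not see
   through. *)
Lemma Derive_A_eta t : J t -> Derive (fun x => A x) t = alpha t.
Proof. intros Ht; exact (is_derive_unique _ _ _ (hA t Ht)). Qed.

Lemma Derive_T_eta t : J t -> Derive (fun x => T x) t = exp (- A t).
Proof. intros Ht; exact (is_derive_unique _ _ _ (hT t Ht)). Qed.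

Lemma Derive_T t : J t -> Derive T t = exp (- A t).
Proof. exact (Derive_T_eta t). Qed.

Lemma elementary_A : elementary J (fun t _ _ => A t).
Proof. apply (elem_primitive J A alpha hA), elem_smooth1, halpha. Qed.

Lemma elementary_opp_A : elementary J (fun t _ _ => - A t).
Proof.
  apply (elem_primitive J (fun t => - A t) (fun t => -1 * alpha t)).
  - intros t Ht; replace (-1 * alpha t) with (- alpha t) by ring.
    apply (is_derive_opp (V := R_NormedModule)), hA, Ht.
  - apply (elem_mult J (fun _ _ _ => -1) (fun t _ _ => alpha t)).
    + apply elem_const.
    + now apply elem_smooth1.
Qed.

Lemma elementary_exp_opp_A : elementary J (fun t _ _ => exp (- A t)).
Proof. apply elem_exp with (f := fun t _ _ => - A t), elementary_opp_A. Qed.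

Lemma elementary_T : elementary J (fun t _ _ => T t).
Proof. apply (elem_primitive J T _ hT), elementary_exp_opp_A. Qed.

Lemma elementary_quadratic k l n : elementary J (fun t _ _ => quadratic k l n t).
Proof.
  assert (ET := elementary_T).
  apply (elem_plus J (fun t _ _ => k * T t ^ 2 + l * T t) (fun _ _ _ => n)); [|apply elem_const].
  apply (elem_plus J (fun t _ _ => k * T t ^ 2) (fun t _ _ => l * T t)).
  - apply (elem_mult J (fun _ _ _ => k) (fun t _ _ => T t ^ 2)); [apply elem_const|].
    apply (elem_mult J (fun t _ _ => T t) (fun t _ _ => T t * 1)); [trivial|].
    apply (elem_mult J (fun t _ _ => T t) (fun _ _ _ => 1)); [trivial|apply elem_const].
  - apply (elem_mult J (fun _ _ _ => l) (fun t _ _ => T t)); [apply elem_const|trivial].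
Qed.

Lemma elementary_smooth1 f : elementary J (fun t _ _ => f t) -> smooth1 J f.
Proof.
  intros Ef; destruct (proj2 (proj2 hX)) as [x Hx], (proj2 (proj2 hU)) as [u Hu].
  apply (smooth3_smooth1 J X U (fun t _ _ => f t) x u Hx Hu).
  now apply elementary_smooth3.
Qed.

Definition tau_of k l n t := exp (A t) * quadratic k l n t.
Definition line k m t := k * T t + m.

Lemma elementary_tau_of k l n : elementary J (fun t _ _ => tau_of k l n t).
Proof.
  apply (elem_mult J (fun t _ _ => exp (A t)) (fun t _ _ => quadratic k l n t)).
  - apply elem_exp with (f := fun t _ _ => A t), elementary_A.
  - apply elementary_quadratic.
Qed.

Lemma elementary_line k m : elementary J (fun t _ _ => line k m t).
Proof.
  apply (elem_plus J (fun t _ _ => k * T t) (fun _ _ _ => m)); [|apply elem_const].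
  apply (elem_mult J (fun _ _ _ => k) (fun t _ _ => T t)); [apply elem_const|apply elementary_T].
Qed.

Lemma is_derive_tau_of k l n t : J t ->
  is_derive (tau_of k l n) t (alpha t * tau_of k l n t + (2 * k * T t + l)).
Proof.
  intros Ht; unfold tau_of, quadratic.
  assert (DA := hA t Ht); assert (DT := hT t Ht).
  auto_derive; [repeat split; eexists; eassumption|].
  rewrite (Derive_A_eta t Ht), (Derive_T_eta t Ht).
  generalize (exp_A_inv t); intros E.
  transitivity (alpha t * (exp (A t) * (k * T t ^ 2 + l * T t + n))
                + exp (A t) * exp (- A t) * (2 * k * T t + l)); [ring|rewrite E; ring].
Qed.

Lemma is_derive_line k m t : J t -> is_derive (line k m) t (k * exp (- A t)).
Proof.
  intros Ht; unfold line.
  assert (DT := hT t Ht).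
  auto_derive; [repeat split; eexists; eassumption|].
  rewrite (Derive_T_eta t Ht); ring.
Qed.

Lemma is_derive_on_J (f g : R -> R) t l : J t ->
  (forall s, J s -> f s = g s) -> is_derive g t l -> is_derive f t l.
Proof.
  intros Ht E; apply is_derive_ext_loc.
  generalize (oJ t Ht); apply filter_imp; intros s Hs; now rewrite E.
Qed.

Lemma Derive_n_2_line k m t : J t -> Derive_n (line k m) 2 t = - alpha t * (k * exp (- A t)).
Proof.
  intros Ht; cbn; apply is_derive_unique.
  apply (is_derive_on_J _ (fun t => k * exp (- A t))); trivial.
  - intros s Hs; now apply is_derive_unique, is_derive_line.
  - assert (DA := hA t Ht); auto_derive; [eexists; eassumption|].
    rewrite (Derive_A_eta t Ht); ring.
Qed.

Lemma Derive_n_2_tau_of k l n t : J t ->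
  Derive_n (tau_of k l n) 2 t
  = Derive alpha t * tau_of k l n t + alpha t * Derive (tau_of k l n) t + 2 * k * exp (- A t).
Proof.
  intros Ht; cbn; apply is_derive_unique.
  apply (is_derive_on_J _ (fun t => alpha t * tau_of k l n t + (2 * k * T t + l))); trivial.
  - intros s Hs; now apply is_derive_unique, is_derive_tau_of.
  - assert (DT := hT t Ht); assert (Da := halpha 1%nat t Ht).
    assert (Dt := is_derive_tau_of k l n t Ht).
    auto_derive; [repeat split; try (eexists; eassumption); exact Da|].
    change (fun x => alpha x) with alpha; change (fun x => tau_of k l n x) with (tau_of k l n).
    rewrite (Derive_T_eta t Ht); ring.
Qed.

Lemma normal_field_reduced k l n m p q :
  vf_eq J X U (normal_field k l n m p q)
    (reduced_field 0 (tau_of k l n) (line k m) (line p q)).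
Proof.
  intros t x u Ht Hx Hu; cbn; repeat split.
  - unfold line; ring.
  - rewrite (is_derive_unique _ _ _ (is_derive_tau_of k l n t Ht)).
    rewrite !(is_derive_unique _ _ _ (is_derive_line _ _ t Ht)).
    unfold tau_of, line; ring.
Qed.

Lemma vf_eq_trans Q P N : vf_eq J X U Q P -> vf_eq J X U P N -> vf_eq J X U Q N.
Proof.
  intros E F t x u Ht Hx Hu.
  destruct (E t x u Ht Hx Hu) as (-> & -> & ->); now apply F.
Qed.

Lemma vf_eq_sym Q P : vf_eq J X U Q P -> vf_eq J X U P Q.
Proof.
  intros E t x u Ht Hx Hu; destruct (E t x u Ht Hx Hu) as (-> & -> & ->); auto.
Qed.

Lemma vf_smooth_normal_field k l n m p q : vf_smooth J X U (normal_field k l n m p q).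
Proof.
  assert (EX := elem_x J); assert (EU := elem_u J); assert (EC := elem_const J).
  assert (El := elementary_line); assert (Et := elementary_tau_of k l n).
  split; [|split].
  - now apply elementary_smooth3.
  - apply elementary_smooth3; trivial.
    apply (elem_plus J (fun t x _ => line k m t * x) (fun t _ _ => line p q t)); trivial.
    now apply (elem_mult J (fun t _ _ => line k m t) (fun _ x _ => x)).
  - apply (smooth3_ext J X U oJ oX oU
      (fun t x u => (line (- k) (m - l) t + (-1) * (alpha t * tau_of k l n t)) * u
                    + exp (- A t) * (k * x + p))).
    { intros t x u _ _ _; unfold line, tau_of; cbn; ring. }
    apply elementary_smooth3; trivial.
    apply (elem_plus J (fun t x u => (line (- k) (m - l) t + (-1) * (alpha t * tau_of k l n t)) * u)
             (fun t x u => exp (- A t) * (k * x + p))).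
    + apply (elem_mult J (fun t _ _ => line (- k) (m - l) t + (-1) * (alpha t * tau_of k l n t))
               (fun _ _ u => u)); trivial.
      apply (elem_plus J (fun t _ _ => line (- k) (m - l) t)
               (fun t _ _ => (-1) * (alpha t * tau_of k l n t))); trivial.
      apply (elem_mult J (fun _ _ _ => -1) (fun t _ _ => alpha t * tau_of k l n t)); trivial.
      apply (elem_mult J (fun t _ _ => alpha t) (fun t _ _ => tau_of k l n t)); trivial.
      now apply elem_smooth1.
    + apply (elem_mult J (fun t _ _ => exp (- A t)) (fun _ x _ => k * x + p)).
      * apply elementary_exp_opp_A.
      * apply (elem_plus J (fun _ x _ => k * x) (fun _ _ _ => p)); trivial.
        now apply (elem_mult J (fun _ _ _ => k) (fun _ x _ => x)).
Qed.

Lemma vf_smooth_ext Q P : vf_eq J X U Q P -> vf_smooth J X U P -> vf_smooth J X U Q.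
Proof.
  intros E (st & sx & se); split; [|split].
  - apply (smooth3_ext J X U oJ oX oU (vtau P)); trivial.
    intros t x u ? ? ?; symmetry; now apply E.
  - apply (smooth3_ext J X U oJ oX oU (vxi P)); trivial.
    intros t x u ? ? ?; symmetry; now apply E.
  - apply (smooth3_ext J X U oJ oX oU (veta P)); trivial.
    intros t x u ? ? ?; symmetry; now apply E.
Qed.

(** * Symmetry algebra and classification for a fixed [beta] *)

Section FixedBeta.

Variable beta : R -> R.
Hypothesis hbeta : admissible J beta.

Lemma Amax_of_normal_field Q k l n m p q :
  vf_eq J X U Q (normal_field k l n m p q) -> classifying beta k l n m ->
  Amax J X U alpha beta Q.
Proof.
  intros EQ HC; split.
  - exact (vf_smooth_ext _ _ EQ (vf_smooth_normal_field _ _ _ _ _ _)).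
  - intros p0 Ht Hx Hu HL.
    assert (sl := fun k m => elementary_smooth1 _ (elementary_line k m)).
    rewrite (prolong5_reduced_field J X U hJ hX hU alpha beta Q 0
      (tau_of k l n) (line k m) (line p q)); trivial.
    + rewrite !Derive_n_2_line, Derive_n_2_tau_of by trivial.
      rewrite (is_derive_unique _ _ _ (is_derive_tau_of k l n _ Ht)).
      rewrite !(is_derive_unique _ _ _ (is_derive_line _ _ _ Ht)).
      assert (Hb := proj2 hbeta _ Ht).
      assert (E : tau_of k l n (p0 ct) * Derive beta (p0 ct)
        = beta (p0 ct) * (3 * k * T (p0 ct) + 5 * m - l - alpha (p0 ct) * tau_of k l n (p0 ct))).
      { rewrite <- (HC _ Ht); unfold log_slope, tau_of; field; trivial. }
      rewrite E; unfold line; ring.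
    + apply hbeta.
    + apply elementary_smooth1, elementary_tau_of.
    + exact (vf_eq_trans _ _ _ EQ (normal_field_reduced _ _ _ _ _ _)).
    + now repeat split.
Qed.

Lemma constant_on_J f : (forall t, J t -> is_derive f t 0) ->
  exists c, forall t, J t -> f t = c.
Proof.
  intros Df; destruct (proj2 (proj2 hJ)) as [t0 H0]; exists (f t0).
  intros t Ht; now apply (constant_of_derive0 J f).
Qed.

Lemma is_derive_Derive f t n : smooth1 J f -> J t ->
  is_derive (Derive_n f n) t (Derive_n f (S n) t).
Proof. intros sf Ht; exact (Derive_correct _ _ (sf (S n) t Ht)). Qed.

(** The integrating factor is [exp A]: the product [f' exp A] is a constant [k], that is
    [f' = k T_t]. *)
Lemma line_of_ode f : smooth1 J f ->
  (forall t, J t -> alpha t * Derive f t + Derive_n f 2 t = 0) ->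
  exists k m, forall t, J t -> f t = line k m t.
Proof.
  intros sf E.
  destruct (constant_on_J (fun t => Derive f t * exp (A t))) as [k Hk].
  { intros t Ht.
    assert (DA := hA t Ht); assert (D1 := is_derive_Derive f t 1 sf Ht).
    assert (D2 := is_derive_comp exp A t _ _ (is_derive_exp (A t)) DA).
    assert (D3 := is_derive_mult _ _ t _ _ D1 D2 Rmult_comm).
    replace 0 with (plus (mult (Derive_n f 2 t) (exp (A t))) (mult (Derive_n f 1 t) (scal (alpha t) (exp (A t))))).
    - exact D3.
    - unfold plus, mult, scal; cbn -[Derive_n]; unfold mult; cbn -[Derive_n].
      change (Derive_n f 1 t) with (Derive f t).
      transitivity (exp (A t) * (alpha t * Derive f t + Derive_n f 2 t)); [ring|].
      rewrite E by trivial; ring. }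
  destruct (constant_on_J (fun t => f t - k * T t)) as [m Hm].
  { intros t Ht; assert (DT := hT t Ht); assert (D := is_derive_Derive f t 0 sf Ht).
    replace 0 with (Derive_n f 1 t - k * exp (- A t)).
    - apply (is_derive_minus (V := R_NormedModule)); [exact D|now apply is_derive_scal].
    - rewrite <- (Hk t Ht), Rmult_assoc, exp_A_inv; cbn; change (fun x => f x) with f; ring. }
  exists k, m; intros t Ht; generalize (Hm t Ht); unfold line; lra.
Qed.

Lemma normal_field_of_Amax Q : Amax J X U alpha beta Q ->
  exists k l n m p q, vf_eq J X U Q (normal_field k l n m p q) /\ classifying beta k l n m.
Proof.
  intros HQ.
  destruct (proj2 (proj2 hX)) as [x0 Hx0], (proj2 (proj2 hU)) as [u0 Hu0].
  set (tau t := vtau Q t x0 u0).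
  set (h t := pd1 dir_x (vxi Q) t x0 u0).
  set (xi t := vxi Q t x0 u0).
  destruct (proj1 HQ) as (st & sx & _).
  assert (st' : smooth1 J tau) by now apply (smooth3_smooth1 J X U).
  assert (sx' : smooth1 J xi) by now apply (smooth3_smooth1 J X U (vxi Q)).
  assert (sh' : smooth1 J h).
  { apply (smooth3_smooth1 J X U (pd1 dir_x (vxi Q))); trivial; now apply smooth3_pd1. }
  assert (EQ : vf_eq J X U Q (reduced_field x0 tau h xi)).
  { intros t x u Ht Hx Hu; repeat split.
    - now apply (tau_form J X U hJ hX hU alpha beta halpha hbeta Q HQ x0 u0).
    - now apply (xi_form J X U hJ hX hU alpha beta halpha hbeta Q HQ x0 u0).
    - now apply (eta_determined J X U hJ hX hU alpha beta halpha hbeta Q HQ x0 u0). }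
  (* All of [x], [u], [u5] are free once [u_t] is solved for, so the coefficients are split off
     below one variable at a time. *)
  assert (D : forall t x u u5, J t -> X x -> U u ->
    u5 * (tau t * Derive beta t + beta t * Derive tau t - 5 * beta t * h t)
    + u * (tau t * Derive alpha t + alpha t * Derive tau t
                  + 2 * Derive h t - Derive_n tau 2 t)
    + (x - x0) * (alpha t * Derive h t + Derive_n h 2 t)
    + (alpha t * Derive xi t + Derive_n xi 2 t) = 0).
  { intros t x u u5 Ht Hx Hu.
    set (p := jet_at t x u 0 0 u5 (- (alpha t * u + beta t * u5)) 0).
    assert (Hp : inbox J X U p) by now repeat split.
    assert (HL : eqn_lhs alpha beta p = 0) by (unfold eqn_lhs; cbn; ring).
    rewrite <- (proj2 HQ p Ht Hx Hu HL).
    now rewrite (prolong5_reduced_field J X U hJ hX hU alpha beta Q x0 tau h xi p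
      halpha (proj1 hbeta) st' sh' sx' EQ Hp HL). }
  clearbody tau h xi.
  assert (Dx : forall t u u5, J t -> U u ->
    alpha t * Derive h t + Derive_n h 2 t = 0
    /\ u5 * (tau t * Derive beta t + beta t * Derive tau t - 5 * beta t * h t)
       + u * (tau t * Derive alpha t + alpha t * Derive tau t
                  + 2 * Derive h t - Derive_n tau 2 t)
       + (alpha t * Derive xi t + Derive_n xi 2 t) = 0).
  { intros t u u5 Ht Hu.
    destruct (affine_zero_on_interval X (alpha t * Derive h t + Derive_n h 2 t)
      (u5 * (tau t * Derive beta t + beta t * Derive tau t - 5 * beta t * h t)
       + u * (tau t * Derive alpha t + alpha t * Derive tau t
                  + 2 * Derive h t - Derive_n tau 2 t)
       + (alpha t * Derive xi t + Derive_n xi 2 t)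
       - x0 * (alpha t * Derive h t + Derive_n h 2 t)) hX) as [E1 E2].
    - intros x Hx; rewrite <- (D t x u u5) by trivial; ring.
    - rewrite E1 in E2; split; [trivial|lra]. }
  assert (Du : forall t u5, J t ->
    tau t * Derive alpha t + alpha t * Derive tau t + 2 * Derive h t - Derive_n tau 2 t = 0
    /\ u5 * (tau t * Derive beta t + beta t * Derive tau t - 5 * beta t * h t)
       + (alpha t * Derive xi t + Derive_n xi 2 t) = 0).
  { intros t u5 Ht; apply (affine_zero_on_interval U); trivial.
    intros u Hu; rewrite <- (proj2 (Dx t u u5 Ht Hu)); ring. }
  destruct (line_of_ode h sh') as (k & m & Hh).
  { intros t Ht; apply (Dx t u0 0 Ht Hu0). }
  destruct (line_of_ode xi sx') as (p & q & Hxi).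
  { intros t Ht; generalize (proj2 (Du t 0 Ht)); lra. }
  assert (Dh : forall t, J t -> Derive h t = k * exp (- A t)).
  { intros t Ht; apply is_derive_unique, (is_derive_on_J _ (line k m)); trivial.
    now apply is_derive_line. }
  assert (Dxi : forall t, J t -> Derive xi t = p * exp (- A t)).
  { intros t Ht; apply is_derive_unique, (is_derive_on_J _ (line p q)); trivial.
    now apply is_derive_line. }
  (* The second-order ODE for [tau] is a total time derivative; this is its first integral. *)
  destruct (constant_on_J (fun t => Derive tau t - alpha t * tau t - 2 * h t)) as [c Hc].
  { intros t Ht; replace 0 with (Derive_n tau 2 t
      - (Derive alpha t * tau t + alpha t * Derive tau t) - 2 * Derive h t)
      by (generalize (proj1 (Du t 0 Ht)); lra).
    apply (is_derive_minus (V := R_NormedModule));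
      [apply (is_derive_minus (V := R_NormedModule))|].
    - exact (is_derive_Derive tau t 1 st' Ht).
    - exact (is_derive_mult _ _ _ _ _ (is_derive_Derive alpha t 0 halpha Ht)
        (is_derive_Derive tau t 0 st' Ht) Rmult_comm).
    - apply is_derive_scal, (is_derive_Derive h t 0 sh' Ht). }
  (* Substituting [h = k T + m] into the first integral leaves [2 m + c] as the constant term. *)
  set (l := 2 * m + c).
  assert (Dt : forall t, J t -> Derive tau t = alpha t * tau t + (2 * k * T t + l)).
  { intros t Ht; generalize (Hc t Ht); rewrite Hh by trivial; unfold line, l; lra. }
  destruct (constant_on_J (fun t => tau t * exp (- A t) - (k * T t ^ 2 + l * T t))) as [n Hn].
  { intros t Ht; assert (DA := hA t Ht); assert (DT := hT t Ht).
    assert (D1 := Derive_correct _ _ (st' 1%nat t Ht) : is_derive tau t (Derive tau t)).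
    rewrite Dt in D1 by trivial.
    auto_derive; [repeat split; eexists; eassumption|].
    change (fun x => tau x) with tau.
    rewrite (Derive_A_eta t Ht), (Derive_T_eta t Ht),
      Dt by trivial; ring. }
  assert (Et : forall t, J t -> tau t = exp (A t) * quadratic k l n t).
  { intros t Ht; unfold quadratic; rewrite <- (Hn t Ht).
    transitivity (tau t * (exp (A t) * exp (- A t))); [rewrite exp_A_inv; ring|ring]. }
  (* The base point moves from [x0] to 0, and the shift is absorbed in the purely time-dependent
     part of [xi]. *)
  exists k, l, n, m, (p - k * x0), (q - m * x0); split.
  - intros t x u Ht Hx Hu; destruct (EQ t x u Ht Hx Hu) as (-> & -> & ->).
    cbn; rewrite Dt, Dh, Dxi, Hh, Hxi, Et by trivial; unfold line; repeat split; ring.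
  - intros t Ht; assert (Hb := proj2 hbeta t Ht).
    assert (E : tau t * Derive beta t + beta t * Derive tau t - 5 * beta t * h t = 0).
    { generalize (proj2 (Du t 0 Ht)) (proj2 (Du t 1 Ht)); lra. }
    rewrite Dt, Hh in E by trivial; unfold line in E.
    unfold log_slope; apply (Rmult_eq_reg_l (beta t)); [|trivial].
    transitivity (exp (A t) * quadratic k l n t * Derive beta t
                  + beta t * (alpha t * (exp (A t) * quadratic k l n t))); [field; trivial|].
    rewrite <- Et by trivial; lra.
Qed.

Lemma zero_on_J_derive f t l : J t -> (forall s, J s -> f s = 0) -> is_derive f t l -> l = 0.
Proof.
  intros Ht E D; rewrite <- (is_derive_unique _ _ _ D).
  apply is_derive_unique, (is_derive_on_J f (fun _ => 0)); trivial.
  apply is_derive_constR.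
Qed.

Lemma line_zero k m : (forall t, J t -> line k m t = 0) -> k = 0 /\ m = 0.
Proof.
  intros E; destruct (proj2 (proj2 hJ)) as [t Ht].
  assert (D := zero_on_J_derive _ t _ Ht E (is_derive_line k m t Ht)).
  assert (k = 0).
  { apply Rmult_integral in D; destruct D as [|D]; [trivial|].
    generalize (exp_pos (- A t)); lra. }
  subst k; generalize (E t Ht); unfold line; split; lra.
Qed.

Lemma quadratic_zero k l n : (forall t, J t -> quadratic k l n t = 0) ->
  k = 0 /\ l = 0 /\ n = 0.
Proof.
  intros E.
  assert (L : forall t, J t -> line (2 * k) l t = 0).
  { intros t Ht.
    assert (Et : forall s, J s -> tau_of k l n s = 0).
    { intros s Hs; unfold tau_of; rewrite E by trivial; ring. }
    assert (D := zero_on_J_derive _ t _ Ht Et (is_derive_tau_of k l n t Ht)).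
    rewrite Et in D by trivial; unfold line; lra. }
  destruct (line_zero _ _ L) as [Ek El].
  assert (k = 0) by lra; subst k l.
  destruct (proj2 (proj2 hJ)) as [t Ht]; generalize (E t Ht); unfold quadratic; lra.
Qed.

Lemma normal_field_inj k l n m p q k' l' n' m' p' q' :
  vf_eq J X U (normal_field k l n m p q) (normal_field k' l' n' m' p' q') ->
  k = k' /\ l = l' /\ n = n' /\ m = m' /\ p = p' /\ q = q'.
Proof.
  intros E; destruct (proj2 (proj2 hX)) as [x Hx], (proj2 (proj2 hU)) as [u Hu].
  destruct (quadratic_zero (k - k') (l - l') (n - n')) as (Ek & El & En).
  { intros t Ht; destruct (E t x u Ht Hx Hu) as (E1 & _); cbn in E1.
    apply Rmult_eq_reg_l in E1; [|generalize (exp_pos (A t)); lra].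
    unfold quadratic in *; lra. }
  assert (Exi : forall t, J t -> line (k - k') (m - m') t = 0 /\ line (p - p') (q - q') t = 0).
  { intros t Ht; apply (affine_zero_on_interval X); trivial.
    intros y Hy; destruct (E t y u Ht Hy Hu) as (_ & E1 & _); cbn in E1.
    unfold line; lra. }
  destruct (line_zero (k - k') (m - m')) as [_ Em]; [apply Exi|].
  destruct (line_zero (p - p') (q - q')) as [Ep Eq]; [apply Exi|].
  repeat split; lra.
Qed.

Lemma vf_zero_normal : vf_eq J X U vf_zero (normal_field 0 0 0 0 0 0).
Proof. intros t x u _ _ _; unfold quadratic; cbn; unfold quadratic; repeat split; ring. Qed.

Lemma classifying_of_Amax Q k l n m p q : Amax J X U alpha beta Q ->
  vf_eq J X U Q (normal_field k l n m p q) -> classifying beta k l n m.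
Proof.
  intros HQ E.
  destruct (normal_field_of_Amax Q HQ) as (k' & l' & n' & m' & p' & q' & E' & HC).
  destruct (normal_field_inj k l n m p q k' l' n' m' p' q') as (-> & -> & -> & -> & _); trivial.
  exact (vf_eq_trans _ _ _ (vf_eq_sym _ _ E) E').
Qed.

Lemma kernel_comb ks : length ks = 2%nat ->
  exists p q, vf_eq J X U (vf_comb ks (kernel_ops T)) (normal_field 0 0 0 0 p q).
Proof.
  destruct ks as [|q [|p [|]]]; try discriminate; intros _; exists p, q.
  intros t x u Ht _ _; unfold quadratic; cbn; unfold quadratic.
  rewrite Derive_T by trivial; repeat split; ring.
Qed.

Lemma in_span_kernel_of_normal Q p q :
  vf_eq J X U Q (normal_field 0 0 0 0 p q) -> in_span J X U (kernel_ops T) Q.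
Proof.
  intros E; exists [q; p]; split; [reflexivity|].
  apply (vf_eq_trans _ _ _ E); intros t x u Ht _ _; cbn; unfold quadratic.
  rewrite Derive_T by trivial; repeat split; ring.
Qed.

Lemma Amax_kernel Q : in_span J X U (kernel_ops T) Q -> Amax J X U alpha beta Q.
Proof.
  intros (ks & Hks & E); destruct (kernel_comb ks Hks) as (p & q & Epq).
  apply (Amax_of_normal_field Q 0 0 0 0 p q).
  - exact (vf_eq_trans _ _ _ E Epq).
  - intros t _; unfold quadratic; ring.
Qed.

Lemma kernel_ops_in_span Q : In Q (kernel_ops T) -> in_span J X U (kernel_ops T) Q.
Proof.
  intros [<-|[<-|[]]]; [exists [1; 0] | exists [0; 1]]; split; trivial;
    intros t x u _ _ _; cbn; repeat split; ring.
Qed.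

(* The resultant of [k T^2 + l T + n] and [3 k T + e], divided by [k]; since it
   is nonzero, the logarithmic slope has no further representation as such a
   quotient. *)
Definition classifying_resultant (k l n m : R) : R :=
  (5 * m - l) ^ 2 - 3 * l * (5 * m - l) + 9 * k * n.

Lemma classifying_unique k1 l1 n1 m1 k l n m :
  classifying_resultant k1 l1 n1 m1 <> 0 ->
  classifying beta k1 l1 n1 m1 -> classifying beta k l n m ->
  exists mu, k = mu * k1 /\ l = mu * l1 /\ n = mu * n1 /\ m = mu * m1.
Proof.
  unfold classifying_resultant; intros HR H1 H.
  set (e1 := 5 * m1 - l1) in *; set (e := 5 * m - l).
  (* Cross-multiplying the two relations eliminates the slope; the cubic terms [3 k k1] cancel, so a
     quadratic in [T] vanishes. *)
  destruct (quadratic_zero (k * e1 + 3 * l * k1 - k1 * e - 3 * l1 * k)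
    (l * e1 + 3 * n * k1 - l1 * e - 3 * n1 * k) (n * e1 - n1 * e)) as (E2 & E1 & E0).
  { intros t Ht.
    transitivity (quadratic k l n t * (3 * k1 * T t + e1) - quadratic k1 l1 n1 t * (3 * k * T t + e));
      [unfold quadratic; ring|].
    replace (3 * k1 * T t + e1) with (quadratic k1 l1 n1 t * log_slope beta t)
      by (rewrite H1 by trivial; unfold e1; ring).
    replace (3 * k * T t + e) with (quadratic k l n t * log_slope beta t)
      by (rewrite H by trivial; unfold e; ring).
    ring. }
  set (r := e1 ^ 2 - 3 * l1 * e1 + 9 * k1 * n1) in *.
  (* The numerator polarizes [r]: it is linear in the second quadruple and equals [r] on the first,
     hence reads off the proportionality factor. *)
  set (mu := (e1 * e - 3 * l1 * e + 9 * k1 * n) / r).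
  assert (S : forall v v1, r * v - (e1 * e - 3 * l1 * e + 9 * k1 * n) * v1 = 0 -> v = mu * v1).
  { intros v v1 E; unfold mu; apply (Rmult_eq_reg_l r); [|trivial]; field_simplify; lra. }
  assert (Sk : k = mu * k1).
  { apply S; unfold r; transitivity (e1 * (k * e1 + 3 * l * k1 - k1 * e - 3 * l1 * k)
      - 3 * k1 * (l * e1 + 3 * n * k1 - l1 * e - 3 * n1 * k)); [ring|rewrite E2, E1; ring]. }
  assert (Sl : l = mu * l1).
  { apply S; unfold r; transitivity ((e1 - 3 * l1) * (l * e1 + 3 * n * k1 - l1 * e - 3 * n1 * k)
      + 3 * n1 * (k * e1 + 3 * l * k1 - k1 * e - 3 * l1 * k) - 3 * k1 * (n * e1 - n1 * e));
      [ring|rewrite E2, E1, E0; ring]. }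
  assert (Sn : n = mu * n1).
  { apply S; unfold r; transitivity ((e1 - 3 * l1) * (n * e1 - n1 * e)); [ring|rewrite E0; ring]. }
  assert (Se : e = mu * e1).
  { apply S; unfold r; transitivity (- 9 * k1 * (n * e1 - n1 * e)); [ring|rewrite E0; ring]. }
  exists mu; repeat split; trivial; unfold e, e1 in Se; lra.
Qed.

(** * Bases from solutions of the classifying condition *)

Lemma basis_one op k1 l1 n1 m1 :
  vf_eq J X U op (normal_field k1 l1 n1 m1 0 0) -> classifying beta k1 l1 n1 m1 ->
  classifying_resultant k1 l1 n1 m1 <> 0 ->
  is_basis J X U (Amax J X U alpha beta) (kernel_ops T ++ [op]).
Proof.
  intros Eop HC HR.
  assert (Comb : forall q p mu, vf_eq J X U (vf_comb [q; p; mu] (kernel_ops T ++ [op]))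
            (normal_field (mu * k1) (mu * l1) (mu * n1) (mu * m1) p q)).
  { intros q p mu t x u Ht Hx Hu; destruct (Eop t x u Ht Hx Hu) as (E1 & E2 & E3).
    cbn; rewrite E1, E2, E3, Derive_T by trivial; cbn; unfold quadratic; repeat split; ring. }
  split; [|split].
  - intros Q HQ; apply in_app_or in HQ; destruct HQ as [HQ|[<-|[]]].
    + now apply Amax_kernel, kernel_ops_in_span.
    + exact (Amax_of_normal_field _ _ _ _ _ _ _ Eop HC).
  - intros Q HQ; destruct (normal_field_of_Amax Q HQ) as (k & l & n & m & p & q & E & HC').
    destruct (classifying_unique k1 l1 n1 m1 k l n m HR HC HC') as (mu & -> & -> & -> & ->).
    exists [q; p; mu]; split; [reflexivity|].
    exact (vf_eq_trans _ _ _ E (vf_eq_sym _ _ (Comb q p mu))).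
  - intros ks Hks E; destruct ks as [|q [|p [|mu [|]]]]; try discriminate.
    destruct (normal_field_inj _ _ _ _ _ _ _ _ _ _ _ _
      (vf_eq_trans _ _ _ (vf_eq_sym _ _ (Comb q p mu)) (vf_eq_trans _ _ _ E vf_zero_normal)))
      as (Ek & El & En & Em & -> & ->).
    assert (mu = 0).
    (* The resultant is homogeneous of degree 2, so its being nonzero also excludes the zero
       field. *)
    { assert (Z : mu * mu * classifying_resultant k1 l1 n1 m1 = 0).
      { transitivity (classifying_resultant (mu * k1) (mu * l1) (mu * n1) (mu * m1)).
        - unfold classifying_resultant; ring.
        - rewrite Ek, El, En, Em; unfold classifying_resultant; ring. }
      apply Rmult_integral in Z; destruct Z as [Z|Z]; [|contradiction].
      apply Rmult_integral in Z; tauto. }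
    intros k [<-|[<-|[<-|[]]]]; trivial.
Qed.

Lemma basis_two op op' k1 l1 n1 m1 k2 l2 n2 m2 :
  vf_eq J X U op (normal_field k1 l1 n1 m1 0 0) -> classifying beta k1 l1 n1 m1 ->
  vf_eq J X U op' (normal_field k2 l2 n2 m2 0 0) -> classifying beta k2 l2 n2 m2 ->
  (forall k l n m, classifying beta k l n m -> exists y z,
     k = y * k1 + z * k2 /\ l = y * l1 + z * l2 /\ n = y * n1 + z * n2 /\ m = y * m1 + z * m2) ->
  (forall y z, y * k1 + z * k2 = 0 -> y * l1 + z * l2 = 0 -> y * n1 + z * n2 = 0 ->
     y = 0 /\ z = 0) ->
  is_basis J X U (Amax J X U alpha beta) (kernel_ops T ++ [op; op']).
Proof.
  intros Eop HC Eop' HC' Span Free.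
  assert (Comb : forall q p y z, vf_eq J X U (vf_comb [q; p; y; z] (kernel_ops T ++ [op; op']))
            (normal_field (y * k1 + z * k2) (y * l1 + z * l2) (y * n1 + z * n2) (y * m1 + z * m2) p q)).
  { intros q p y z t x u Ht Hx Hu; destruct (Eop t x u Ht Hx Hu) as (E1 & E2 & E3).
    destruct (Eop' t x u Ht Hx Hu) as (E1' & E2' & E3').
    cbn; rewrite E1, E2, E3, E1', E2', E3', Derive_T by trivial; cbn; unfold quadratic.
    repeat split; ring. }
  split; [|split].
  - intros Q HQ; apply in_app_or in HQ; destruct HQ as [HQ|[<-|[<-|[]]]].
    + now apply Amax_kernel, kernel_ops_in_span.
    + exact (Amax_of_normal_field _ _ _ _ _ _ _ Eop HC).
    + exact (Amax_of_normal_field _ _ _ _ _ _ _ Eop' HC').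
  - intros Q HQ; destruct (normal_field_of_Amax Q HQ) as (k & l & n & m & p & q & E & HCQ).
    destruct (Span k l n m HCQ) as (y & z & -> & -> & -> & ->).
    exists [q; p; y; z]; split; [reflexivity|].
    exact (vf_eq_trans _ _ _ E (vf_eq_sym _ _ (Comb q p y z))).
  - intros ks Hks E; destruct ks as [|q [|p [|y [|z [|]]]]]; try discriminate.
    destruct (normal_field_inj _ _ _ _ _ _ _ _ _ _ _ _
      (vf_eq_trans _ _ _ (vf_eq_sym _ _ (Comb q p y z)) (vf_eq_trans _ _ _ E vf_zero_normal)))
      as (Ek & El & En & Em & -> & ->).
    destruct (Free y z Ek El En) as [-> ->].
    intros k [<-|[<-|[<-|[<-|[]]]]]; trivial.
Qed.

Lemma basis_kernel :
  (forall k l n m, classifying beta k l n m -> k = 0 /\ l = 0 /\ n = 0) ->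
  is_basis J X U (Amax J X U alpha beta) (kernel_ops T).
Proof.
  intros Only; split; [|split].
  - intros Q HQ; now apply Amax_kernel, kernel_ops_in_span.
  - intros Q HQ; destruct (normal_field_of_Amax Q HQ) as (k & l & n & m & p & q & E & HC).
    destruct (Only k l n m HC) as (-> & -> & ->).
    assert (m = 0).
    { destruct (proj2 (proj2 hJ)) as [t Ht]; generalize (HC t Ht); unfold quadratic; lra. }
    subst m; exact (in_span_kernel_of_normal Q p q E).
  - intros ks Hks E; destruct ks as [|q [|p [|]]]; try discriminate.
    assert (Comb : vf_eq J X U (vf_comb [q; p] (kernel_ops T)) (normal_field 0 0 0 0 p q)).
    { intros t x u Ht Hx Hu; cbn; unfold quadratic; rewrite Derive_T by trivial.
      repeat split; ring. }
    destruct (normal_field_inj _ _ _ _ _ _ _ _ _ _ _ _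
      (vf_eq_trans _ _ _ (vf_eq_sym _ _ Comb) (vf_eq_trans _ _ _ E vf_zero_normal)))
      as (_ & _ & _ & _ & -> & ->).
    intros k [<-|[<-|[]]]; trivial.
Qed.

(* Squaring removes the sign of [lam] and of the bases of the powers. *)
Lemma log_slope_of_square lam W delta : lam <> 0 ->
  (forall t, J t -> beta t ^ 2 = (lam * Derive T t) ^ 2 * W t) ->
  forall t, J t -> is_derive W t (2 * delta * exp (- A t) * W t) ->
  log_slope beta t = delta.
Proof.
  intros Hlam E t Ht DW.
  assert (Hb := proj2 hbeta t Ht).
  assert (Db := Derive_correct _ _ (proj1 hbeta 1%nat t Ht) : is_derive beta t (Derive beta t)).
  assert (DA := hA t Ht).
  assert (D1 : is_derive (fun t => beta t ^ 2) t (2 * beta t * Derive beta t)).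
  { auto_derive; [now exists (Derive beta t)|]; change (fun x => beta x) with beta; ring. }
  assert (D2 : is_derive (fun t => beta t ^ 2) t
    (2 * (delta * exp (- A t) - alpha t) * ((lam * exp (- A t)) ^ 2 * W t))).
  { apply (is_derive_on_J _ (fun t => (lam * exp (- A t)) ^ 2 * W t)); trivial.
    - intros s Hs; rewrite <- (Derive_T s Hs); now apply E.
    - auto_derive; [split; [now exists (alpha t)|split; [eexists; eassumption|trivial]]|].
      rewrite Derive_A_eta by trivial.
      replace (Derive (fun x => W x) t) with (2 * delta * exp (- A t) * W t)
        by (symmetry; now apply is_derive_unique).
      ring. }
  rewrite <- (Derive_T t Ht), <- E, (Derive_T t Ht) in D2 by trivial.
  assert (F : 2 * beta t * Derive beta t
    = 2 * (delta * exp (- A t) - alpha t) * beta t ^ 2).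
  { rewrite <- (is_derive_unique _ _ _ D1); now apply is_derive_unique. }
  assert (G : Derive beta t = (delta * exp (- A t) - alpha t) * beta t).
  { apply (Rmult_eq_reg_l (2 * beta t)); [rewrite F; ring|].
    apply Rmult_integral_contrapositive_currified; [lra|trivial]. }
  unfold log_slope; rewrite G.
  transitivity (delta * (exp (A t) * exp (- A t))); [field; trivial|].
  rewrite exp_A_inv; ring.
Qed.

(** One differentiable formula for both readings of the power, positive base or integer exponent. *)
Lemma is_rpow_square z r y : is_rpow z r y -> z <> 0 /\ y ^ 2 = exp (r * ln (z ^ 2)).
Proof.
  intros [[Hz ->]|[Hz [n [-> ->]]]].
  - split; [lra|]; unfold Rpower.
    replace (z ^ 2) with (z * z) by ring; rewrite ln_mult by trivial.
    replace (exp (r * ln z) ^ 2) with (exp (r * ln z) * exp (r * ln z)) by ring.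
    rewrite <- exp_plus; f_equal; ring.
  - split; [trivial|].
    assert (Hz2 : 0 < z ^ 2) by now apply pow2_gt_0.
    change (exp (IZR n * ln (z ^ 2))) with (Rpower (z ^ 2) (IZR n)).
    rewrite <- powerRZ_Rpower by trivial.
    replace (z ^ 2) with (z * z) by ring; rewrite powerRZ_mult; ring.
Qed.

Lemma is_derive_ln_square_line a b t : J t -> a * T t + b <> 0 ->
  is_derive (fun t => ln ((a * T t + b) ^ 2)) t (2 * a * exp (- A t) / (a * T t + b)).
Proof.
  intros Ht N; assert (DT := hT t Ht).
  auto_derive; [split; [eexists; eassumption|split; [|trivial]]|].
  - generalize (pow2_gt_0 _ N); cbn; lra.
  - rewrite Derive_T_eta by trivial; field; trivial.
Qed.

(** * Logarithmic slopes of the listed forms *)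

Lemma log_slope_case1 lam a b c d rho : lam <> 0 ->
  (forall t, J t -> exists y z,
            is_rpow (a * T t + b) rho y /\ is_rpow (c * T t + d) (3 - rho) z
            /\ beta t = lam * Derive T t * y * z) ->
  forall t, J t ->
  (a * T t + b) * (c * T t + d) * log_slope beta t
  = 3 * a * c * T t + rho * a * d + (3 - rho) * b * c.
Proof.
  intros Hlam E t Ht.
  assert (Nz : a * T t + b <> 0 /\ c * T t + d <> 0).
  { destruct (E t Ht) as (y & z & Hy & Hz & _).
    split; [exact (proj1 (is_rpow_square _ _ _ Hy))|exact (proj1 (is_rpow_square _ _ _ Hz))]. }
  destruct Nz as [N1 N2].
  rewrite (log_slope_of_square lam
    (fun t => exp (rho * ln ((a * T t + b) ^ 2) + (3 - rho) * ln ((c * T t + d) ^ 2)))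
    (rho * a / (a * T t + b) + (3 - rho) * c / (c * T t + d))); trivial.
  - field; now split.
  - intros s Hs; destruct (E s Hs) as (y & z & Hy & Hz & ->).
    rewrite exp_plus, <- (proj2 (is_rpow_square _ _ _ Hy)), <- (proj2 (is_rpow_square _ _ _ Hz)); ring.
  - assert (D1 := is_derive_ln_square_line a b t Ht N1).
    assert (D2 := is_derive_ln_square_line c d t Ht N2).
    assert (D3 := is_derive_plus _ _ t _ _ (is_derive_scal _ t rho _ D1) (is_derive_scal _ t (3 - rho) _ D2)).
    assert (D4 := is_derive_comp exp _ t _ _ (is_derive_exp _) D3).
    match goal with |- is_derive _ _ ?l => match type of D4 with is_derive _ _ ?l' =>
      replace l with l'; [exact D4|] end end.
    unfold plus, scal; cbn -[pow]; unfold mult; cbn -[pow]; field; now split.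
Qed.

Lemma log_slope_case2 lam a b c d : lam <> 0 ->
  (forall t, J t -> c * T t + d <> 0
        /\ beta t = lam * Derive T t * (c * T t + d) ^ 3
                    * exp ((a * T t + b) / (c * T t + d))) ->
  forall t, J t ->
  (c * T t + d) ^ 2 * log_slope beta t = 3 * c * (c * T t + d) + (a * d - b * c).
Proof.
  intros Hlam E t Ht; destruct (E t Ht) as [N _].
  rewrite (log_slope_of_square lam
    (fun t => ((c * T t + d) ^ 3 * exp ((a * T t + b) / (c * T t + d))) ^ 2)
    (3 * c / (c * T t + d) + (a * d - b * c) / (c * T t + d) ^ 2)); trivial.
  - field; trivial.
  - intros s Hs; rewrite (proj2 (E s Hs)); ring.
  - assert (DT := hT t Ht).
    auto_derive; [repeat split; try (eexists; eassumption); trivial|].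
    rewrite Derive_T_eta by trivial; unfold Rdiv; field; trivial.
Qed.

Lemma calH_square a b c d t : calH T a b c d t ^ 2 = (a * T t + b) ^ 2 + (c * T t + d) ^ 2.
Proof.
  unfold calH; rewrite pow2_sqrt; [trivial|].
  apply Rplus_le_le_0_compat; apply pow2_ge_0.
Qed.

(** The [T]-derivative of [atan ((a T + b) / (c T + d))] is [(a d - b c) / calH^2], and that of
    [ln calH] is [(a (a T + b) + c (c T + d)) / calH^2]. *)
Lemma log_slope_case3 lam a b c d nu : lam <> 0 ->
  (forall t, J t -> c * T t + d <> 0
        /\ beta t = lam * Derive T t
                    * exp (5 * nu * atan ((a * T t + b) / (c * T t + d)))
                    * calH T a b c d t ^ 3) ->
  forall t, J t ->
  calH T a b c d t ^ 2 * log_slope beta t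
  = 3 * (a * (a * T t + b) + c * (c * T t + d)) + 5 * nu * (a * d - b * c).
Proof.
  intros Hlam E t Ht; destruct (E t Ht) as [N _].
  assert (P : 0 < (a * T t + b) ^ 2 + (c * T t + d) ^ 2)
    by (generalize (pow2_ge_0 (a * T t + b)) (pow2_gt_0 _ N); lra).
  rewrite calH_square.
  rewrite (log_slope_of_square lam
    (fun t => exp (5 * nu * atan ((a * T t + b) / (c * T t + d))) ^ 2
              * ((a * T t + b) ^ 2 + (c * T t + d) ^ 2) ^ 3)
    ((3 * (a * (a * T t + b) + c * (c * T t + d)) + 5 * nu * (a * d - b * c))
     / ((a * T t + b) ^ 2 + (c * T t + d) ^ 2))); trivial.
  - field; lra.
  - intros s Hs; rewrite (proj2 (E s Hs)).
    rewrite <- calH_square; ring.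
  - assert (DT := hT t Ht).
    auto_derive; [repeat split; try (eexists; eassumption); trivial|].
    rewrite Derive_T_eta by trivial; unfold Rdiv; field.
    split; [lra|trivial].
Qed.

Lemma log_slope_case4a lam : lam <> 0 ->
  (forall t, J t -> beta t = lam * Derive T t) -> forall t, J t -> log_slope beta t = 0.
Proof.
  intros Hlam E t Ht; apply (log_slope_of_square lam (fun _ => 1)); trivial.
  - intros s Hs; rewrite (E s Hs); ring.
  - rewrite Rmult_0_r, !Rmult_0_l; apply is_derive_constR.
Qed.

Lemma log_slope_case4b c d :
  (forall t, J t -> beta t = Derive T t * (c * T t + d) ^ 3) ->
  forall t, J t -> (c * T t + d) * log_slope beta t = 3 * c.
Proof.
  intros E t Ht.
  assert (N : c * T t + d <> 0).
  { intros Z; apply (proj2 hbeta t Ht); rewrite (E t Ht), Z; ring. }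
  rewrite (log_slope_of_square 1 (fun t => (c * T t + d) ^ 6) (3 * c / (c * T t + d))); trivial.
  - field; trivial.
  - intros s Hs; rewrite (E s Hs); ring.
  - assert (DT := hT t Ht).
    auto_derive; [repeat split; eexists; eassumption|].
    rewrite Derive_T_eta by trivial; field; trivial.
Qed.

Lemma inv_Derive_T t : J t -> / Derive T t = exp (A t).
Proof. intros Ht; rewrite Derive_T, exp_Ropp, Rinv_inv by trivial; reflexivity. Qed.

(** * The listed operators complete a basis *)

Lemma extension_case_basis ops : extension_case J alpha T beta ops ->
  is_basis J X U (Amax J X U alpha beta) (kernel_ops T ++ ops).
Proof.
  intros [lam a b c d rho Hl H0 H3 HD E|lam a b c d Hl HD E|lam a b c d nu Hl HD E
         |lam Hl E|c d Hc E].
  (* In each case [k1], [l1], [n1] are the coefficients in [T] of the operator's [tau T_t], and [m1]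
     is the constant term of the factor of [x] in its [xi]. *)
  - apply basis_one with (k1 := 5 * a * c) (l1 := 5 * (a * d + b * c)) (n1 := 5 * b * d)
      (m1 := a * d * (rho + 1) + b * c * (4 - rho)).
    + intros t x u Ht _ _; cbn; unfold quadratic.
      rewrite inv_Derive_T, Derive_T by trivial; repeat split; ring.
    + intros t Ht.
      transitivity (5 * ((a * T t + b) * (c * T t + d) * log_slope beta t));
        [unfold quadratic; ring|].
      rewrite (log_slope_case1 lam a b c d rho Hl E t Ht); ring.
    (* The excluded exponents 0 and 3 are exactly the zeros of the resultant, where a root of [S]
       cancels. *)
    + replace (classifying_resultant _ _ _ _)
        with (25 * rho * (rho - 3) * (a * d - b * c) ^ 2)
        by (unfold classifying_resultant; ring).
      repeat apply Rmult_integral_contrapositive_currified; try lra.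
  - apply basis_one with (k1 := 5 * c ^ 2) (l1 := 10 * c * d) (n1 := 5 * d ^ 2)
      (m1 := 5 * c * d + (a * d - b * c)).
    + intros t x u Ht _ _; cbn; unfold quadratic.
      rewrite inv_Derive_T, Derive_T by trivial; repeat split; ring.
    + intros t Ht.
      transitivity (5 * ((c * T t + d) ^ 2 * log_slope beta t)); [unfold quadratic; ring|].
      rewrite (log_slope_case2 lam a b c d Hl E t Ht); ring.
    + replace (classifying_resultant _ _ _ _) with (25 * (a * d - b * c) ^ 2)
        by (unfold classifying_resultant; ring).
      generalize (pow2_gt_0 _ HD); lra.
  - apply basis_one with (k1 := a ^ 2 + c ^ 2) (l1 := 2 * (a * b + c * d)) (n1 := b ^ 2 + d ^ 2)
      (m1 := a * b + c * d + nu * (a * d - b * c)).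
    + intros t x u Ht _ _; cbn -[calH pow]; unfold quadratic.
      rewrite calH_square, inv_Derive_T, Derive_T by trivial; repeat split; ring.
    + intros t Ht.
      transitivity (calH T a b c d t ^ 2 * log_slope beta t);
        [rewrite calH_square; unfold quadratic; ring|].
      rewrite (log_slope_case3 lam a b c d nu Hl E t Ht); ring.
    + replace (classifying_resultant _ _ _ _)
        with ((25 * nu ^ 2 + 9) * (a * d - b * c) ^ 2)
        by (unfold classifying_resultant; ring).
      apply Rmult_integral_contrapositive_currified.
      * generalize (pow2_ge_0 nu); lra.
      * generalize (pow2_gt_0 _ HD); lra.
  - assert (L := log_slope_case4a lam Hl E).
    apply basis_two with (k1 := 0) (l1 := 0) (n1 := 1) (m1 := 0)
      (k2 := 0) (l2 := 5) (n2 := 0) (m2 := 1).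
    + intros t x u Ht _ _; cbn; unfold quadratic.
      rewrite inv_Derive_T by trivial; repeat split; ring.
    + intros t Ht; rewrite L by trivial; ring.
    + intros t x u Ht _ _; cbn; unfold quadratic.
      rewrite inv_Derive_T by trivial; repeat split; ring.
    + intros t Ht; rewrite L by trivial; ring.
    (* Slope 0 forces [k = 0] and [l = 5 m], which leaves [n] and [m] as coordinates. *)
    + intros k l n m HC; destruct (line_zero (3 * k) (5 * m - l)) as [Ek El].
      { intros t Ht; generalize (HC t Ht); rewrite L by trivial; unfold line; lra. }
      exists n, m; repeat split; lra.
    + intros y z; lra.
  - assert (L := log_slope_case4b c d E).
    apply basis_two with (k1 := 0) (l1 := 5 * c) (n1 := 5 * d) (m1 := 4 * c)
      (k2 := c ^ 2) (l2 := 2 * c * d) (n2 := d ^ 2) (m2 := c * d).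
    + intros t x u Ht _ _; cbn; unfold quadratic.
      rewrite inv_Derive_T by trivial; repeat split; ring.
    + intros t Ht; transitivity (5 * ((c * T t + d) * log_slope beta t));
        [unfold quadratic; ring|rewrite L by trivial; ring].
    + intros t x u Ht _ _; cbn; unfold quadratic.
      rewrite inv_Derive_T, Derive_T by trivial; repeat split; ring.
    + intros t Ht; transitivity ((c * T t + d) * ((c * T t + d) * log_slope beta t));
        [unfold quadratic; ring|rewrite L by trivial; ring].
    + intros k l n m HC.
      (* Multiplying the classifying relation by [c T + d] and inserting the known slope; the [T^2]
         terms [3 c k] cancel. *)
      destruct (quadratic_zero 0 (3 * c * l - (c * (5 * m - l) + 3 * k * d))
        (3 * c * n - d * (5 * m - l))) as (_ & E1 & E0).
      { intros t Ht.
        transitivity (quadratic k l n t * ((c * T t + d) * log_slope beta t)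
          - (c * T t + d) * (quadratic k l n t * log_slope beta t)); [|ring].
        rewrite L, HC by trivial; unfold quadratic; ring. }
      (* Only the second operator has a [T^2] term, [c^2], which gives its factor. The other factor
         is read from [5 m - l], whose values on the two operators are [15 c] and [3 c d]. *)
      exists ((5 * m - l - 3 * d * k / c) / (15 * c)), (k / c ^ 2).
      assert (F : 3 * c * l = c * (5 * m - l) + 3 * k * d) by lra.
      assert (G : n = d * (5 * m - l) / (3 * c)).
      { apply (Rmult_eq_reg_l (3 * c)); [field_simplify; lra|lra]. }
      assert (Gl : l = (5 * m + 3 * k * d / c) / 4).
      { apply (Rmult_eq_reg_l (4 * c)); [field_simplify; lra|lra]. }
      rewrite G, Gl; repeat split; field; trivial.
    + intros y z E1 E2 _.
      assert (z = 0).
      { apply (Rmult_eq_reg_r (c ^ 2)); [lra|now apply pow_nonzero]. }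
      subst z; split; [|trivial]; apply (Rmult_eq_reg_r (5 * c)); lra.
Qed.

(** * From the logarithmic slope back to the form of [beta] *)

Lemma form_of_log_slope w : (forall t, J t -> w t <> 0) ->
  (forall t, J t -> is_derive w t (w t * log_slope beta t * exp (- A t))) ->
  exists lam, lam <> 0 /\ forall t, J t -> beta t = lam * Derive T t * w t.
Proof.
  intros Nw Dw.
  (* [beta] and [T_t w] have the same logarithmic derivative, so their quotient is constant. *)
  destruct (constant_on_J (fun t => beta t * exp (A t) / w t)) as [lam Hlam].
  { intros t Ht; assert (DA := hA t Ht); assert (Dwt := Dw t Ht).
    assert (Db : ex_derive beta t) by exact (proj1 hbeta 1%nat t Ht).
    auto_derive; [repeat split; try (eexists; eassumption); auto|].
    rewrite Derive_A_eta by trivial.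
    replace (Derive (fun x => w x) t) with (w t * log_slope beta t * exp (- A t))
      by (symmetry; now apply is_derive_unique).
    change (fun x => beta x) with beta; unfold log_slope.
    rewrite exp_Ropp; field.
    repeat split; [now apply Nw|generalize (exp_pos (A t)); lra|now apply hbeta]. }
  assert (E : forall t, J t -> beta t = lam * Derive T t * w t).
  { intros t Ht; rewrite <- (Hlam t Ht), Derive_T, exp_Ropp by trivial; field.
    split; [generalize (exp_pos (A t)); lra|now apply Nw]. }
  exists lam; split; [|exact E].
  destruct (proj2 (proj2 hJ)) as [t Ht]; intros ->.
  apply (proj2 hbeta t Ht); rewrite E by trivial; ring.
Qed.

Lemma continuous_log_slope t : J t -> continuous (log_slope beta) t.
Proof.
  intros Ht; apply (ex_derive_continuous (V := R_NormedModule)); unfold log_slope.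
  assert (DA := hA t Ht).
  assert (Da : ex_derive alpha t) by exact (halpha 1%nat t Ht).
  assert (Db : ex_derive beta t) by exact (proj1 hbeta 1%nat t Ht).
  assert (Db' : ex_derive (Derive beta) t) by exact (proj1 hbeta 2%nat t Ht).
  auto_derive; repeat split; trivial; try (eexists; eassumption); now apply hbeta.
Qed.

(** Where [f] is nonzero it stays so nearby by continuity, and the affine function of [T] would
    vanish on an open set; as [T_t] is never 0, this forces [a = b = 0]. The cancellation thus holds
    even at zeros of [a T + b]. *)
Lemma line_factor_out a b (f : R -> R) : a <> 0 \/ b <> 0 ->
  (forall t, J t -> continuous f t) ->
  (forall t, J t -> (a * T t + b) * f t = 0) -> forall t, J t -> f t = 0.
Proof.
  intros Hab Cf E t Ht; destruct (Req_dec (f t) 0) as [Z|N]; [trivial|exfalso].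
  assert (L : locally t (fun s => line a b s = 0)).
  { assert (O : locally t (fun s => f s <> 0))
      by exact (Cf t Ht (fun y => y <> 0) (open_neq 0 (f t) N)).
    generalize (filter_and _ _ O (oJ t Ht)); apply filter_imp.
    intros s [Ns Hs]; destruct (Rmult_integral _ _ (E s Hs)); [trivial|contradiction]. }
  assert (D : a * exp (- A t) = 0).
  { rewrite <- (is_derive_unique _ _ _ (is_derive_line a b t Ht)).
    rewrite (Derive_ext_loc _ (fun _ => 0)) by exact L; apply Derive_const. }
  assert (a = 0).
  { apply Rmult_integral in D; destruct D as [|D]; [trivial|].
    generalize (exp_pos (- A t)); lra. }
  generalize (locally_singleton _ _ L); unfold line; subst a; intros; lra.
Qed.

(** The quotient of the function by its absolute value is locally constant, hence constant on the
    interval. *)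
Lemma line_sign a b : (forall t, J t -> a * T t + b <> 0) ->
  (forall t, J t -> 0 < a * T t + b) \/ (forall t, J t -> a * T t + b < 0).
Proof.
  intros N; destruct (constant_on_J (fun t => line a b t / Rabs (line a b t))) as [c Hc].
  { intros t Ht.
    assert (C : continuous (line a b) t)
      by (eapply (ex_derive_continuous (V := R_NormedModule)); eexists; now apply is_derive_line).
    destruct (Rtotal_order (line a b t) 0) as [S|[S|S]].
    - apply (is_derive_ext_loc (fun _ => -1)); [|apply is_derive_constR].
      assert (O : locally t (fun s => line a b s < 0))
        by exact (C (fun y => y < 0) (open_lt 0 _ S)).
      generalize O; apply filter_imp.
      intros s Hs; rewrite Rabs_left by trivial.
      change (@eq R (-1) (line a b s / - line a b s)); field; lra.
    - now destruct (N t Ht).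
    - apply (is_derive_ext_loc (fun _ => 1)); [|apply is_derive_constR].
      assert (O : locally t (fun s => 0 < line a b s))
        by exact (C (fun y => 0 < y) (open_gt 0 _ S)).
      generalize O; apply filter_imp.
      intros s Hs; rewrite Rabs_right by lra.
      change (@eq R 1 (line a b s / line a b s)); field; lra. }
  unfold line in Hc; destruct (Rle_lt_dec c 0) as [Lc|Lc]; [right|left]; intros t Ht.
  - destruct (Rtotal_order (a * T t + b) 0) as [S|[S|S]]; [trivial|now destruct (N t Ht)|].
    generalize (Hc t Ht); rewrite Rabs_right by lra.
    replace ((a * T t + b) / (a * T t + b)) with 1 by (field; lra); lra.
  - destruct (Rtotal_order (a * T t + b) 0) as [S|[S|S]]; [|now destruct (N t Ht)|trivial].
    generalize (Hc t Ht); rewrite Rabs_left by trivial.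
    replace ((a * T t + b) / - (a * T t + b)) with (-1) by (field; lra); lra.
Qed.

(** Case 4b carries no factor [lam]: its cube root is absorbed into [c] and [d]. *)
Lemma real_cube_root y : exists z, z ^ 3 = y.
Proof.
  assert (P : forall y, 0 < y -> exists z, z ^ 3 = y).
  { clear; intros y Hy; exists (exp (ln y / 3)).
    rewrite <- (exp_ln y Hy) at 2.
    replace (ln y) with (ln y / 3 + (ln y / 3 + ln y / 3)) at 2 by field.
    rewrite !exp_plus; ring. }
  destruct (Rtotal_order y 0) as [S|[->|S]]; [|exists 0; ring|now apply P].
  destruct (P (- y)) as [z Hz]; [lra|]; exists (- z).
  replace ((- z) ^ 3) with (- z ^ 3) by ring; lra.
Qed.

Lemma extension_of_cube c d : c <> 0 \/ d <> 0 ->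
  (forall t, J t -> (c * T t + d) * log_slope beta t = 3 * c) ->
  exists ops, extension_case J alpha T beta ops.
Proof.
  intros Hcd E; destruct (Req_dec c 0) as [->|Hc].
  - destruct (form_of_log_slope (fun _ => 1)) as (lam & Hl & F).
    + intros; lra.
    + intros t Ht.
      assert (log_slope beta t = 0) as ->.
      { apply (Rmult_eq_reg_l d); [generalize (E t Ht)|]; lra. }
      rewrite Rmult_0_r, Rmult_0_l; apply is_derive_constR.
    + exists (ops4a alpha T); apply (Case4a J alpha T beta lam Hl).
      intros t Ht; rewrite F by trivial; ring.
  - assert (N : forall t, J t -> c * T t + d <> 0).
    { intros t Ht Z; generalize (E t Ht); rewrite Z; lra. }
    destruct (form_of_log_slope (fun t => (c * T t + d) ^ 3)) as (lam & Hl & F).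
    + intros t Ht; now apply pow_nonzero, N.
    + intros t Ht; assert (DT := hT t Ht).
      auto_derive; [repeat split; eexists; eassumption|].
      rewrite Derive_T_eta by trivial.
      transitivity ((c * T t + d) ^ 2 * (3 * c) * exp (- A t)); [ring|].
      rewrite <- (E t Ht); ring.
    + destruct (real_cube_root lam) as [mu Hmu].
      exists (ops4b alpha T (mu * c) (mu * d)); apply Case4b.
      * intros Z; apply Rmult_integral in Z; destruct Z as [->|Z]; [|contradiction].
        apply Hl; rewrite <- Hmu; ring.
      * intros t Ht; rewrite F, <- Hmu by trivial; ring.
Qed.

Lemma extension_of_powers a b c d rho :
  rho <> 0 -> rho <> 3 -> a * d - b * c <> 0 ->
  (forall t, J t -> 0 < a * T t + b) -> (forall t, J t -> 0 < c * T t + d) ->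
  (forall t, J t -> (a * T t + b) * (c * T t + d) * log_slope beta t
     = 3 * a * c * T t + rho * a * d + (3 - rho) * b * c) ->
  exists ops, extension_case J alpha T beta ops.
Proof.
  intros R0 R3 HD P1 P2 E.
  destruct (form_of_log_slope
    (fun t => Rpower (a * T t + b) rho * Rpower (c * T t + d) (3 - rho))) as (lam & Hl & F).
  - intros t Ht; unfold Rpower; apply Rgt_not_eq, Rmult_lt_0_compat; apply exp_pos.
  - intros t Ht; assert (DT := hT t Ht); assert (Q1 := P1 t Ht); assert (Q2 := P2 t Ht).
    assert (log_slope beta t = (3 * a * c * T t + rho * a * d + (3 - rho) * b * c)
              / ((a * T t + b) * (c * T t + d))) as ->.
    { rewrite <- (E t Ht); field; lra. }
    unfold Rpower; auto_derive; [repeat split; trivial; eexists; eassumption|].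
    rewrite Derive_T_eta by trivial; field; lra.
  - exists [op1 alpha T a b c d rho]; apply (Case1 J alpha T beta lam); trivial.
    intros t Ht; exists (Rpower (a * T t + b) rho), (Rpower (c * T t + d) (3 - rho)).
    split; [left; auto|split; [left; auto|]].
    rewrite F by trivial; ring.
Qed.

Lemma extension_of_real_roots a b c d rho :
  a * d - b * c <> 0 ->
  (forall t, J t -> (a * T t + b) * (c * T t + d) * log_slope beta t
     = 3 * a * c * T t + rho * a * d + (3 - rho) * b * c) ->
  exists ops, extension_case J alpha T beta ops.
Proof.
  intros HD E.
  assert (Hab : a <> 0 \/ b <> 0).
  { destruct (Req_dec a 0) as [->|]; [right; intros ->; lra|now left]. }
  assert (Hcd : c <> 0 \/ d <> 0).
  { destruct (Req_dec c 0) as [->|]; [right; intros ->; lra|now left]. }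
  assert (C : forall a b k t, J t -> continuous (fun t => (a * T t + b) * log_slope beta t - k) t).
  { intros a' b' k t Ht.
    apply (continuous_minus (V := R_NormedModule)); [|apply continuous_const].
    apply (continuous_mult (K := R_AbsRing)); [|now apply continuous_log_slope].
    apply (ex_derive_continuous (V := R_NormedModule)); eexists; now apply (is_derive_line a' b'). }
  destruct (Req_dec rho 0) as [->|R0]; [|destruct (Req_dec rho 3) as [->|R3]].
  - apply (extension_of_cube c d Hcd); intros t Ht.
    apply Rminus_diag_uniq, (line_factor_out a b (fun t => (c * T t + d) * log_slope beta t - 3 * c)); auto.
    intros s Hs; generalize (E s Hs); intros F.
    transitivity ((a * T s + b) * (c * T s + d) * log_slope beta s - 3 * c * (a * T s + b)); [ring|].
    rewrite F; ring.
  - apply (extension_of_cube a b Hab); intros t Ht.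
    apply Rminus_diag_uniq, (line_factor_out c d (fun t => (a * T t + b) * log_slope beta t - 3 * a)); auto.
    intros s Hs; generalize (E s Hs); intros F.
    transitivity ((a * T s + b) * (c * T s + d) * log_slope beta s - 3 * a * (c * T s + d)); [ring|].
    rewrite F; ring.
  (* At a zero of [a T + b] the right-hand side equals [rho (a d - b c)], which is nonzero; at a
     zero of [c T + d] it equals [(3 - rho) (b c - a d)] up to sign. *)
  - assert (N1 : forall t, J t -> a * T t + b <> 0).
    { intros t Ht Z; generalize (E t Ht); rewrite Z, !Rmult_0_l; intros F.
      assert (G : rho * (a * d - b * c) = 0).
      { transitivity (3 * a * c * T t + rho * a * d + (3 - rho) * b * c - 3 * c * (a * T t + b));
          [ring|rewrite Z, <- F; ring]. }
      apply Rmult_integral in G; tauto. }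
    assert (N2 : forall t, J t -> c * T t + d <> 0).
    { intros t Ht Z; generalize (E t Ht); rewrite Z, Rmult_0_r, !Rmult_0_l; intros F.
      assert (G : (rho - 3) * (a * d - b * c) = 0).
      { transitivity (3 * a * c * T t + rho * a * d + (3 - rho) * b * c - 3 * a * (c * T t + d));
          [ring|rewrite Z, <- F; ring]. }
      apply Rmult_integral in G; destruct G; [lra|contradiction]. }
    assert (HDN : - (a * d - b * c) <> 0) by lra.
    (* Negating one linear factor negates both sides of the relation and keeps [rho], so both bases
       can be made positive, as [Rpower] requires. *)
    destruct (line_sign a b N1) as [S1|S1], (line_sign c d N2) as [S2|S2].
    + now apply (extension_of_powers a b c d rho).
    + apply (extension_of_powers a b (- c) (- d) rho); trivial; intros.
      * lra.
      * generalize (S2 t H); lra.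
      * generalize (E t H); lra.
    + apply (extension_of_powers (- a) (- b) c d rho); trivial; intros.
      * lra.
      * generalize (S1 t H); lra.
      * generalize (E t H); lra.
    + apply (extension_of_powers (- a) (- b) (- c) (- d) rho); trivial; intros.
      * lra.
      * generalize (S1 t H); lra.
      * generalize (S2 t H); lra.
      * generalize (E t H); lra.
Qed.

Lemma extension_of_double_root c d e : c <> 0 \/ d <> 0 ->
  (forall t, J t -> (c * T t + d) ^ 2 * log_slope beta t = 3 * c * (c * T t + d) + e) ->
  exists ops, extension_case J alpha T beta ops.
Proof.
  intros Hcd E; destruct (Req_dec e 0) as [->|He].
  - apply (extension_of_cube c d Hcd); intros t Ht.
    apply Rminus_diag_uniq, (line_factor_out c d (fun t => (c * T t + d) * log_slope beta t - 3 * c)); auto.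
    + intros s Hs; apply (continuous_minus (V := R_NormedModule)); [|apply continuous_const].
      apply (continuous_mult (K := R_AbsRing)); [|now apply continuous_log_slope].
      apply (ex_derive_continuous (V := R_NormedModule)); eexists; now apply (is_derive_line c d).
    + intros s Hs; generalize (E s Hs); lra.
  - assert (N : forall t, J t -> c * T t + d <> 0).
    { intros t Ht Z; generalize (E t Ht); rewrite Z; lra. }
    assert (S : 0 < c ^ 2 + d ^ 2).
    { generalize (pow2_ge_0 c) (pow2_ge_0 d); destruct Hcd as [H|H]; generalize (pow2_gt_0 _ H); lra. }
    (* Any [(a, b)] with determinant [e] would do: two choices differ by a multiple of [(c, d)],
       which changes the exponential by a constant factor. This one is orthogonal to [(c, d)]. *)
    set (a := e * d / (c ^ 2 + d ^ 2)); set (b := - e * c / (c ^ 2 + d ^ 2)).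
    assert (HD : a * d - b * c = e) by (unfold a, b; field; lra).
    destruct (form_of_log_slope
      (fun t => (c * T t + d) ^ 3 * exp ((a * T t + b) / (c * T t + d)))) as (lam & Hl & F).
    + intros t Ht; apply Rmult_integral_contrapositive_currified; [now apply pow_nonzero, N|].
      apply Rgt_not_eq, exp_pos.
    + intros t Ht; assert (DT := hT t Ht); assert (Nt := N t Ht).
      assert (log_slope beta t = (3 * c * (c * T t + d) + (a * d - b * c)) / (c * T t + d) ^ 2) as ->.
      { rewrite HD, <- (E t Ht); field; trivial. }
      clearbody a b.
      auto_derive; [repeat split; trivial; eexists; eassumption|].
      rewrite Derive_T_eta by trivial; unfold Rdiv; field; trivial.
    + exists [op2 alpha T a b c d]; apply (Case2 J alpha T beta lam); trivial.
      * now rewrite HD.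
      * intros t Ht; split; [auto|rewrite F by trivial; ring].
Qed.

(** The monic [S] with roots [- b + i d] and [- b - i d] needs only [a = 1], [c = 0] in Case 3; then
    [a d - b c] is [d]. *)
Lemma extension_of_complex_roots b d nu : d <> 0 ->
  (forall t, J t -> ((T t + b) ^ 2 + d ^ 2) * log_slope beta t = 3 * (T t + b) + 5 * nu * d) ->
  exists ops, extension_case J alpha T beta ops.
Proof.
  intros Hd E.
  assert (P : forall t, 0 < (1 * T t + b) ^ 2 + (0 * T t + d) ^ 2).
  { intros t; generalize (pow2_ge_0 (1 * T t + b)) (pow2_gt_0 _ Hd); rewrite Rmult_0_l, Rplus_0_l; lra. }
  assert (N : forall t, 0 * T t + d <> 0) by (intros; lra).
  destruct (form_of_log_slope (fun t => exp (5 * nu * atan ((1 * T t + b) / (0 * T t + d)))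
                                        * calH T 1 b 0 d t ^ 3)) as (lam & Hl & F).
  - intros t Ht; apply Rmult_integral_contrapositive_currified; [apply Rgt_not_eq, exp_pos|].
    apply pow_nonzero, Rgt_not_eq, sqrt_lt_R0, P.
  - intros t Ht; assert (DT := hT t Ht).
    assert (log_slope beta t = (3 * (T t + b) + 5 * nu * d) / (calH T 1 b 0 d t) ^ 2) as ->.
    { rewrite <- (E t Ht), calH_square; field; generalize (P t); lra. }
    assert (DH : is_derive (calH T 1 b 0 d) t ((T t + b) * exp (- A t) / calH T 1 b 0 d t)).
    { unfold calH; auto_derive; [repeat split; trivial; try (eexists; eassumption)|].
      - generalize (P t); cbn; lra.
      - rewrite Derive_T_eta by trivial; cbn; field.
        apply Rgt_not_eq, sqrt_lt_R0; generalize (P t); cbn; lra. }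
    assert (PH : 0 < calH T 1 b 0 d t) by apply sqrt_lt_R0, P.
    assert (QH := calH_square 1 b 0 d t).
    set (H := calH T 1 b 0 d) in *; clearbody H.
    auto_derive; [repeat split; trivial; eexists; eassumption|].
    rewrite Derive_T_eta by trivial.
    replace (Derive (fun x => H x) t) with ((T t + b) * exp (- A t) / H t)
      by (symmetry; now apply is_derive_unique).
    replace (/ (1 + (1 * T t + b) * / (0 * T t + d) * ((1 * T t + b) * / (0 * T t + d) * 1)))
      with (d ^ 2 / H t ^ 2).
    + unfold Rdiv; field; repeat split; trivial; lra.
    + rewrite QH; field; split; [trivial|generalize (P t); lra].
  - exists [op3 alpha T 1 b 0 d nu]; apply (Case3 J alpha T beta lam); trivial.
    + lra.
    + intros t Ht; split; [trivial|rewrite F by trivial; ring].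
Qed.

Lemma extension_of_classifying k l n m :
  classifying beta k l n m -> ~ (k = 0 /\ l = 0 /\ n = 0) ->
  exists ops, extension_case J alpha T beta ops.
Proof.
  intros HC NZ; set (e := 5 * m - l).
  assert (E : forall t, J t -> quadratic k l n t * log_slope beta t = 3 * k * T t + e).
  { intros t Ht; rewrite HC by trivial; unfold e; ring. }
  clearbody e; clear HC; unfold quadratic in E.
  destruct (Req_dec k 0) as [->|Hk].
  - destruct (Req_dec l 0) as [->|Hl].
    + assert (Hn : n <> 0) by (intros ->; now apply NZ).
      (* A constant [S] has a double root at infinity, encoded by the linear function [0 T + 1]. *)
      apply (extension_of_double_root 0 1 (e / n)); [right; lra|].
      intros t Ht; apply (Rmult_eq_reg_l n); [|trivial].
      transitivity (3 * 0 * T t + e); [rewrite <- (E t Ht); ring|field; trivial].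
    + apply (extension_of_real_roots l n 0 1 (e / l)); [lra|].
      intros t Ht; transitivity (3 * 0 * T t + e); [rewrite <- (E t Ht); ring|field; trivial].
  - set (D := l ^ 2 - 4 * k * n); destruct (Rtotal_order D 0) as [S|[S|S]].
    + set (d := sqrt (- D) / (2 * k)).
      assert (Hs : 0 < sqrt (- D)) by (apply sqrt_lt_R0; lra).
      assert (Hd : d <> 0).
      { unfold d; intros Z; apply (f_equal (fun y => y * (2 * k))) in Z.
        replace (sqrt (- D) / (2 * k) * (2 * k)) with (sqrt (- D)) in Z by (field; trivial); lra. }
      assert (Hd2 : d ^ 2 = n / k - (l / (2 * k)) ^ 2).
      { unfold d; transitivity (sqrt (- D) ^ 2 / (2 * k) ^ 2); [field; trivial|].
        rewrite pow2_sqrt by lra; unfold D; field; trivial. }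
      clearbody d.
      (* Completing the square gives the first two arguments; [nu] solves [e / k = 3 b + 5 nu d]. *)
      apply (extension_of_complex_roots (l / (2 * k)) d ((e / k - 3 * (l / (2 * k))) / (5 * d)) Hd).
      intros t Ht; rewrite Hd2; apply (Rmult_eq_reg_l k); [|trivial].
      transitivity (3 * k * T t + e); [rewrite <- (E t Ht); field; trivial|field; auto].
    + apply (extension_of_double_root 1 (l / (2 * k)) (e / k - 3 * (l / (2 * k)))); [left; lra|].
      assert (Hn : n = l ^ 2 / (4 * k)).
      { apply (Rmult_eq_reg_l (4 * k)); [|lra]; transitivity (l ^ 2); [unfold D in S; lra|field; trivial]. }
      intros t Ht; apply (Rmult_eq_reg_l k); [|trivial].
      transitivity (3 * k * T t + e); [rewrite <- (E t Ht), Hn; field; trivial|field; trivial].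
    + set (r := sqrt D).
      assert (Hr : 0 < r) by (apply sqrt_lt_R0; lra).
      assert (Hr2 : r ^ 2 = l ^ 2 - 4 * k * n) by (unfold r; rewrite pow2_sqrt by lra; reflexivity).
      assert (Hn : n = (l + r) / 2 * ((l - r) / (2 * k))).
      { transitivity ((l ^ 2 - r ^ 2) / (4 * k)); [rewrite Hr2; field; trivial|field; trivial]. }
      clearbody r.
      (* The factors are [k T + (l + r) / 2] and [T + (l - r) / (2 k)], with determinant [- r]. The
         constant term of the numerator is [rho (a d - b c) + 3 b c]; equating it to [e] gives
         [rho]. *)
      apply (extension_of_real_roots k ((l + r) / 2) 1 ((l - r) / (2 * k))
               ((e - 3 * ((l + r) / 2)) / (- r))).
      * replace (k * ((l - r) / (2 * k)) - (l + r) / 2 * 1) with (- r) by (field; trivial); lra.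
      * intros t Ht; transitivity (3 * k * T t + e).
        -- rewrite <- (E t Ht), Hn; field; trivial.
        -- field; split; [lra|trivial].
Qed.

End FixedBeta.

Lemma log_slope_exp f t (l : R) : J t -> is_derive f t l ->
  log_slope (fun t => exp (f t - A t)) t = exp (A t) * l.
Proof.
  intros Ht Df; assert (DA := hA t Ht); unfold log_slope.
  replace (Derive (fun t => exp (f t - A t)) t) with ((l - alpha t) * exp (f t - A t)).
  - field; apply Rgt_not_eq, exp_pos.
  - symmetry; apply is_derive_unique.
    auto_derive; [repeat split; eexists; eassumption|].
    rewrite Derive_A_eta by trivial.
    replace (Derive (fun x => f x) t) with l by (symmetry; now apply is_derive_unique).
    unfold Rminus; ring.
Qed.

Lemma admissible_exp f : elementary J (fun t _ _ => f t) ->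
  admissible J (fun t => exp (f t - A t)).
Proof.
  intros Ef; split; [|intros; apply Rgt_not_eq, exp_pos].
  apply elementary_smooth1, elem_exp with (f := fun t _ _ => f t - A t).
  exact (elem_plus J (fun t _ _ => f t) (fun t _ _ => - A t) Ef elementary_opp_A).
Qed.

(* Two test functions suffice: [beta = T_t] and [beta = T_t exp T], whose
   logarithmic slopes are the constants 0 and 1. *)
Lemma kernel_of_all_beta Q :
  (forall beta, admissible J beta -> Amax J X U alpha beta Q) ->
  in_span J X U (kernel_ops T) Q.
Proof.
  intros H.
  assert (B0 : admissible J (fun t => exp (0 - A t)))
    by apply (admissible_exp (fun _ => 0)), elem_const.
  assert (B1 : admissible J (fun t => exp (T t - A t)))
    by apply (admissible_exp T), elementary_T.
  destruct (normal_field_of_Amax _ B0 Q (H _ B0)) as (k & l & n & m & p & q & E & C0).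
  assert (C1 := classifying_of_Amax _ B1 Q _ _ _ _ _ _ (H _ B1) E).
  destruct (line_zero (3 * k) (5 * m - l)) as [Ek El].
  { intros t Ht; generalize (C0 t Ht).
    rewrite (log_slope_exp (fun _ => 0) t 0) by (trivial; apply is_derive_constR).
    unfold line; lra. }
  destruct (quadratic_zero k l n) as (-> & -> & ->).
  { intros t Ht; generalize (C1 t Ht).
    rewrite (log_slope_exp T t _ Ht (hT t Ht)), exp_A_inv.
    assert (k = 0) by lra; subst k; lra. }
  replace m with 0 in E by lra.
  exact (in_span_kernel_of_normal Q p q E).
Qed.

End NormalForm.

(** * Properness of the extensions and the classification *)

Lemma span_kernel_not_basis J X U V T op ops :
  is_basis J X U V (kernel_ops T ++ op :: ops) -> ~ in_span J X U (kernel_ops T) op.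
Proof.
  intros (_ & _ & Free) (ks & Hks & E).
  destruct ks as [|x [|y [|]]]; try discriminate.
  assert (Z : forall ops', vf_eq J X U (vf_comb (repeat 0 (length ops')) ops') vf_zero).
  { induction ops' as [|Q ops' IH]; intros t x' u Ht Hx Hu; [now repeat split|].
    destruct (IH t x' u Ht Hx Hu) as (E1 & E2 & E3); cbn in *.
    unfold vf_comb in *; rewrite E1, E2, E3; repeat split; ring. }
  assert (F : -1 = 0); [|lra].
  (* Membership of [op] in the span is a linear relation among the basis elements, with coefficient
     -1 at [op]. *)
  apply (Free (x :: y :: -1 :: repeat 0 (length ops))).
  - cbn; now rewrite repeat_length.
  - intros t x' u Ht Hx Hu; destruct (E t x' u Ht Hx Hu) as (E1 & E2 & E3).
    destruct (Z ops t x' u Ht Hx Hu) as (F1 & F2 & F3); cbn in *.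
    unfold vf_comb in *; rewrite E1, E2, E3, F1, F2, F3; repeat split; ring.
  - right; right; left; reflexivity.
Qed.

Theorem mainTheorem4 (J X U : R -> Prop)
  (hJ : nonempty_open_interval J) (hX : nonempty_open_interval X) (hU : nonempty_open_interval U)
  (alpha : R -> R) (halpha : smooth1 J alpha)
  (* [A] and [T] are the fixed antiderivatives of alpha and of exp (- A) *)
  (A T : R -> R)
  (hA : forall t, J t -> is_derive A t (alpha t))
  (hT : forall t, J t -> is_derive T t (exp (- A t))) :
  (* the algebra admitted for arbitrary beta *)
  (forall Q,
     (forall beta, admissible J beta -> Amax J X U alpha beta Q)
     <-> in_span J X U (kernel_ops T) Q)
  /\
  forall beta, admissible J beta ->
    (* the extensions occur exactly in the listed cases *)
    ((exists Q, Amax J X U alpha beta Q /\ ~ in_span J X U (kernel_ops T) Q)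
       <-> exists ops, extension_case J alpha T beta ops)
    /\ ((~ exists ops, extension_case J alpha T beta ops) ->
          is_basis J X U (Amax J X U alpha beta) (kernel_ops T))
    /\ (forall ops, extension_case J alpha T beta ops ->
          is_basis J X U (Amax J X U alpha beta) (kernel_ops T ++ ops)).
Proof.
  split.
  - intros Q; split.
    + now apply (kernel_of_all_beta J X U hJ hX hU alpha A T).
    + intros HQ beta hbeta; now apply (Amax_kernel J X U hJ hX hU alpha A T).
  - intros beta hbeta.
    assert (Basis := extension_case_basis J X U hJ hX hU alpha A T halpha hA hT beta hbeta).
    assert (Only : ~ (exists ops, extension_case J alpha T beta ops) ->
      is_basis J X U (Amax J X U alpha beta) (kernel_ops T)).
    { intros No; apply (basis_kernel J X U hJ hX hU alpha A T halpha hA hT beta hbeta).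
      intros k l n m HC.
      (* A solution with nonzero [S] would put [beta] into one of the listed forms. *)
      destruct (Req_dec k 0), (Req_dec l 0), (Req_dec n 0); try tauto;
        destruct No; apply (extension_of_classifying J hJ alpha A T halpha hA hT beta hbeta k l n m HC); tauto. }
    split; [split|split]; trivial.
    + intros (Q & HQ & NQ); apply NNPP; intros No.
      now apply NQ, (Only No).
    + intros [ops Hops]; assert (B := Basis ops Hops).
      destruct ops as [|op ops]; [inversion Hops|].
      exists op; split.
      * apply B, in_or_app; right; now left.
      * exact (span_kernel_not_basis _ _ _ _ _ _ _ B).
Qed.
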